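(* Let $D$ and $D'$ be oriented virtual singular link diagrams related by planar isotopy and a finite sequence of extended Reidemeister moves. Then $R(D)=R(D')$ in $\mathbb{Z}[A,A^{-1},h]$; i.e. $R$ is an ambient isotopy invariant of virtual singular links.
   Context: An oriented virtual singular link diagram is a generic immersion of finitely many oriented circles into $\mathbb{R}^2$ with finitely many transverse double points, each decorated as a classical crossing (with over/under information and the usual sign $\pm1$), a singular crossing, or a virtual crossing. The extended Reidemeister moves (all orientation versions) are: classical $R_1,R_2,R_3$; $RS_1$: a strand passing entirely over (or under) a singular crossing may be slid across it; $RS_2$: when two strands meet consecutively in a singular crossing and a classical crossing, the classical crossing may be moved to the other side of the singular crossing; purely virtual $V_1,V_2,V_{3-v}$; $V_{3-c}$ (resp. $V_{3-s}$): a strand with two consecutive virtual crossings may be slid across a classical (resp. singular) crossing. At a classical or singular crossing, the oriented resolution replaces it by two disjoint arcs respecting orientation; the disoriented resolution replaces it by one arc joining the two incoming ends with a sink bivalent vertex on it (both edges oriented toward the vertex) and one arc joining the two outgoing ends with a source bivalent vertex (both edges oriented away). Virtual crossings are kept. A state $S$ of $D$ is a choice of resolution at every classical and singular crossing; it is a collection of immersed closed curves (all intersections virtual) with bivalent vertices, edge orientations alternating. $\|S\|$ is the number of closed curves; $c(D)$ the number of classical crossings; $a(S)$ = #(negative classical crossings with oriented resolution) $-$ #(positive classical crossings with oriented resolution); $b(S)$ the same difference for disoriented resolutions; $\alpha(S)$, $\beta(S)$ the numbers of singular crossings with oriented, resp. disoriented, resolution. Parity: an edge of $S$ is an arc between consecutive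 bivalent vertices (a closed curve without vertices is one edge). A weight map is $\tau:E(S)\to\{1,-1\}$ with $\tau(e)\ne\tau(e')$ whenever $e,e'$ share a bivalent vertex. For a virtual crossing $v$ where edges $e,e'$ meet (possibly $e=e'$), $i_\tau(v)=\tau(e)\tau(e')$, and $i(S)=\prod_v i_\tau(v)$ over all virtual crossings of $S$; this is independent of $\tau$. Define $$R(D)=(-1)^{c(D)}\sum_S A^{2a(S)+4b(S)}(-A^2-A^{-2})^{\alpha(S)+\|S\|}(-A^4-A^{-4})^{\beta(S)}h^{\frac{1-i(S)}{2}}.$$ *)

(* Defs.v *)
From HB Require Import structures.
From mathcomp Require Import all_boot all_order all_algebra fraction.
From Stdlib Require Import ClassicalEpsilon.
From Stdlib Require Sorting.Permutation Relations.Relation_Operators.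
Set Implicit Arguments. Unset Strict Implicit. Unset Printing Implicit Defensive.
Import Order.TTheory GRing.Theory Num.Theory.

Inductive ckind := Pos | Neg | Sing | Virt.

(* A crossing, given by the labels of the four (oriented) edge-ends meeting
   at it, listed COUNTERCLOCKWISE as  i1, i2, o1, o2 : the two incoming ends
   i1, i2 are adjacent (i2 follows i1 counterclockwise), the two strands
   through the crossing are i1 -> o1 and i2 -> o2.  For a classical crossing,
   [Pos] means the strand i1 -> o1 is the over strand, [Neg] means it is the
   under strand; with this normalisation [Pos] crossings are exactly the
   crossings of sign +1 and [Neg] those of sign -1. *)
Record crossing := Cr { ck : ckind; i1 : nat; i2 : nat; o1 : nat; o2 : nat }.

(* A diagram: its double points (edges are labelled by natural numbers; an
   edge runs from the crossing where its label is an outgoing end to the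
   crossing where it is an incoming end) together with a number of closed
   components without any double point. *)
Record diagram := Diagram { crs : seq crossing; loops : nat }.

Definition ins (D : diagram) : seq nat := flatten [seq [:: i1 c; i2 c] | c <- crs D].
Definition outs (D : diagram) : seq nat := flatten [seq [:: o1 c; o2 c] | c <- crs D].

Definition wf (D : diagram) : bool :=
  [&& uniq (ins D), uniq (outs D) & perm_eq (ins D) (outs D)].

Definition dummy_cr := Cr Virt 0 0 0 0.
Definition crs_at (D : diagram) (k : nat) : crossing := nth dummy_cr (crs D) k.
Definition slot (c : crossing) (j : nat) : nat := nth 0 [:: i1 c; i2 c; o1 c; o2 c] j.

Definition dart (D : diagram) := ('I_(size (crs D)) * 'I_4)%type.
Definition lab (D : diagram) (d : dart D) : nat := slot (crs_at D d.1) d.2.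
Definition alpha (D : diagram) (d : dart D) : dart D :=
  odflt d [pick d' : dart D | (d' != d) && (lab d' == lab d)].
Definition rot (D : diagram) (d : dart D) : dart D := (d.1, inord (d.2.+1 %% 4)).
Definition face_perm (D : diagram) (d : dart D) : dart D := rot (alpha d).
Definition nfaces (D : diagram) : nat := fcard (@face_perm D) (predT : {pred dart D}).
Definition share_edge (D : diagram) : rel 'I_(size (crs D)) :=
  fun k k' => [exists j : 'I_4, exists j' : 'I_4, lab ((k, j) : dart D) == lab ((k', j') : dart D)].
Definition ncomp_cr (D : diagram) : nat :=
  n_comp (@share_edge D) (predT : {pred 'I_(size (crs D))}).

(* The underlying 4-valent map is planar (every connected component is
   embedded in the sphere): Euler's formula V - E + F = 2 per component,
   with E = 2V. *)
Definition planar (D : diagram) : bool := nfaces D == size (crs D) + 2 * ncomp_cr D.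

Definition valid (D : diagram) : bool := wf D && planar D.

(* unoriented description of a crossing used to write local pictures:
   counterclockwise slots s0 s1 s2 s3, strands s0-s2 and s1-s3;
   [UCl true] : strand s0-s2 over, [UCl false] : strand s1-s3 over. *)
Inductive ukind := UCl of bool | USing | UVirt.

(* [ux k s0 s1 s2 s3 f02 f13] : the oriented crossing whose slot s0 (resp s1)
   is an incoming end iff f02 (resp f13) *)
Definition ux (k : ukind) (s0 s1 s2 s3 : nat) (f02 f13 : bool) : crossing :=
  let '(a, b, c, d, first02) :=
    match f02, f13 with
    | true, true => (s0, s1, s2, s3, true)
    | true, false => (s3, s0, s1, s2, false)
    | false, true => (s1, s2, s3, s0, false)
    | false, false => (s2, s3, s0, s1, true)
    end in
  let kd := match k with
            | UCl over02 => if over02 == first02 then Pos else Neg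
            | USing => Sing
            | UVirt => Virt end in
  Cr kd a b c d.

(* through-strand of a removed tangle, entering by label u and leaving by w *)
Definition sp (d : bool) (u w : nat) : nat * nat := if d then (u, w) else (w, u).

Definition is_R1_kind (k : ukind) : bool := if k is USing then false else true.

(* Local pictures [basic_move T T' ps]: the tangle T (list of crossings) is
   replaced by T'; ps lists the through-strands of T to be reconnected when
   T' has fewer crossings (empty otherwise). All orientations are covered by
   the direction parameters d*. *)
Inductive basic_move : seq crossing -> seq crossing -> seq (nat * nat) -> Prop :=
(* R1 (k classical) and V1 (k virtual); the two curls *)
| mv_R1a k (d : bool) a x c : is_R1_kind k ->
    basic_move [:: ux k a x x c d d] [::] [:: sp d a c]
| mv_R1b k (d : bool) a x c : is_R1_kind k ->
    basic_move [:: ux k a c x x d (~~ d)] [::] [:: sp d a c]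
(* R2 (both classical, same strand over) and V2 (both virtual) *)
| mv_R2 k (dA dB : bool) a b c d p q : is_R1_kind k ->
    basic_move [:: ux k a b p q dA dB; ux k p d c q dA (~~ dB)] [::]
               [:: sp dA a c; sp dB b d]
(* triangle moves: R3, RS1, V3-v, V3-c, V3-s; strand H moves across the
   double point of strands P and N *)
| mv_3 kHP kHN kPN (dH dP dN : bool) h1 h2 h3 p1 p2 p3 n1 n2 n3 h2' p2' n2' :
    match kHP, kHN, kPN with
    | UCl hp, UCl hn, UCl pn =>   (* R3: the three heights are linearly ordered *)
        ~~ [&& hp, pn & ~~ hn] && ~~ [&& ~~ hp, ~~ pn & hn]
    | UCl hp, UCl hn, USing => hp == hn
    | UVirt, UVirt, UVirt => true
    | UVirt, UVirt, UCl _ => true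
    | UVirt, UVirt, USing => true
    | _, _, _ => false
    end ->
    basic_move
      [:: ux kHP h1 p1 h2 p2 dH dP; ux kHN h2 n1 h3 n2 dH dN; ux kPN p2 n2 p3 n3 dP dN]
      [:: ux kPN p1 n1 p2' n2' dP dN; ux kHN h1 n2' h2' n3 dH dN; ux kHP h2' p2' h3 p3 dH dP]
      [::]
| mv_RS2 (b dL dR : bool) l1 l2 l3 r1 r2 r3 l2' r2' :
    basic_move
      [:: ux (UCl b) l1 r1 l2 r2 dL dR; ux USing r2 l2 r3 l3 dR dL]
      [:: ux USing l1 r1 l2' r2' dL dR; ux (UCl b) r2' l2' r3 l3 dR dL]
      [::].

Definition relab (f : nat -> nat) (c : crossing) : crossing :=
  Cr (ck c) (f (i1 c)) (f (i2 c)) (f (o1 c)) (f (o2 c)).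

(* reconnecting the through-strands (u, w) after removing a tangle: the edge
   leaving by w is merged with the edge entering by u; when both are already
   the same edge a crossingless closed component is created. Returns the
   relabelling of the rest of the diagram and the number of new free loops. *)
Fixpoint join (ps : seq (nat * nat)) (s : nat -> nat) (l : nat) : (nat -> nat) * nat :=
  match ps with
  | [::] => (s, l)
  | (u, w) :: ps' =>
      let u' := s u in let w' := s w in
      if u' == w' then join ps' s l.+1
      else join ps' (fun x => if s x == w' then u' else s x) l
  end.

Definition move_step (D D' : diagram) : Prop :=
  exists T T' ps rest, basic_move T T' ps /\
    Permutation.Permutation (crs D) (rest ++ T) /\
    let j := join ps id 0 in
    Permutation.Permutation (crs D') (map (relab j.1) rest ++ T') /\
    loops D' = loops D + j.2.

(* planar isotopy (on the combinatorial level): relabelling of edges and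
   reordering of crossings *)
Definition iso_step (D D' : diagram) : Prop :=
  exists f : nat -> nat, injective f /\
    Permutation.Permutation (map (relab f) (crs D)) (crs D') /\ loops D = loops D'.

Definition ext_step (D D' : diagram) : Prop :=
  valid D /\ valid D' /\ (move_step D D' \/ iso_step D D').

Definition ext_equiv : diagram -> diagram -> Prop :=
  Relation_Operators.clos_refl_sym_trans diagram ext_step.

Definition is_virt (c : crossing) : bool := if ck c is Virt then true else false.
Definition is_classical (c : crossing) : bool :=
  match ck c with Pos | Neg => true | _ => false end.
Definition kind_eq (k k' : ckind) : bool :=
  match k, k' with
  | Pos, Pos | Neg, Neg | Sing, Sing | Virt, Virt => true | _, _ => false end.

(* a state: [s k = true] oriented resolution, [false] disoriented; virtual
   crossings are kept (forced to [true], which is ignored for them) *)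
Definition state (D : diagram) := {ffun 'I_(size (crs D)) -> bool}.
Definition is_state (D : diagram) (s : state D) : bool :=
  [forall k : 'I_(size (crs D)), is_virt (crs_at D k) ==> s k].

Definition cnt (D : diagram) (s : state D) (kd : ckind) (o : bool) : nat :=
  #|[pred k : 'I_(size (crs D)) | kind_eq (ck (crs_at D k)) kd && (s k == o)]|.

Definition partner_slot (c : crossing) (o : bool) (j : nat) : nat :=
  if is_virt c then (j + 2) %% 4          (* pass through: i1-o1, i2-o2 *)
  else if o then 3 - j                    (* oriented: i1-o2, i2-o1 *)
  else if odd j then j.-1 else j.+1.      (* disoriented: i1-i2 (sink), o1-o2 (source) *)
Definition partner (D : diagram) (s : state D) (d : dart D) : dart D :=
  (d.1, inord (partner_slot (crs_at D d.1) (s d.1) d.2)).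
Definition curve_rel (D : diagram) (s : state D) : rel (dart D) :=
  fun d d' => [|| d' == alpha d, d' == partner s d, d == alpha d' | d == partner s d'].
Definition ncurves (D : diagram) (s : state D) : nat :=
  n_comp (curve_rel s) (predT : {pred dart D}) + loops D.

(* junctions of edge labels at a crossing: (x, y, bivalent vertex?) *)
Definition junctions (c : crossing) (o : bool) : seq (nat * nat * bool) :=
  if is_virt c then [:: (i1 c, o1 c, false); (i2 c, o2 c, false)]
  else if o then [:: (i2 c, o1 c, false); (i1 c, o2 c, false)]
  else [:: (i1 c, i2 c, true); (o1 c, o2 c, true)].

(* weight maps (true = 1, false = -1) on edge labels: constant along the edges
   of S, alternating at the bivalent vertices *)
Definition weight_map (D : diagram) (s : state D) (tau : nat -> bool) : Prop :=
  forall k : 'I_(size (crs D)),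
    all (fun j : nat * nat * bool => (tau j.1.1 == tau j.1.2) == ~~ j.2)
        (junctions (crs_at D k) (s k)).

Definition some_weight_map (D : diagram) (s : state D) : nat -> bool :=
  epsilon (inhabits (fun _ => true)) (weight_map s).

Definition iS (D : diagram) (s : state D) : int :=
  let tau := some_weight_map s in
  \prod_(k < size (crs D) | is_virt (crs_at D k))
     (if tau (i1 (crs_at D k)) == tau (i2 (crs_at D k)) then 1 else -1).

Local Open Scope ring_scope.

Definition Rgen (K : fieldType) (A h : K) (D : diagram) : K :=
  (-1) ^+ count is_classical (crs D) *
  \sum_(s : state D | is_state s)
     (A ^ (2 * ((cnt s Neg true)%:Z - (cnt s Pos true)%:Z)
           + 4 * ((cnt s Neg false)%:Z - (cnt s Pos false)%:Z)) *
      (- A ^+ 2 - A ^- 2) ^+ (cnt s Sing true + ncurves s)%N *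
      (- A ^+ 4 - A ^- 4) ^+ cnt s Sing false *
      (if iS s == 1 then 1 else h)).   (* = h ^ ((1 - i(S)) / 2) *)

(* Z[A, A^-1, h] embedded in the fraction field of Z[A][h] *)
Definition LField := {fraction {poly {poly int}}}.
Definition varA : LField := tofrac (('X : {poly int})%:P).
Definition varh : LField := tofrac ('X : {poly {poly int}}).

Definition R (D : diagram) : LField := Rgen varA varh D.

(* Main.v *)
Require Import Defs.
From mathcomp Require Import all_boot all_order all_algebra fraction.
From mathcomp Require Import zify ring.
From Stdlib Require Import FunctionalExtensionality ClassicalEpsilon.
From Stdlib Require Sorting.Permutation Relations.Relation_Operators.
Set Implicit Arguments. Unset Strict Implicit. Unset Printing Implicit Defensive.
Import Order.TTheory GRing.Theory Num.Theory.

(** Write delta = -A^2 - A^-2. A closed curve of a state carries exactly two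
    weight maps, so a state S has 2^||S|| of them and delta^||S|| can be read off
    their number; splitting that number according to the value of
    the product of the i_tau(v) also recovers i(S), once one knows that this
    product does not depend on tau. The latter is where planarity enters: two
    weight maps differ by a Z/2-cycle z of the underlying map, on a sphere z is
    the boundary of a set of faces, and going along the curves on which z
    vanishes one changes sides of that set exactly at the virtual crossings
    of the two kinds of curves, hence an even number of times.

    Counting weight maps is a local process: the number of weight maps of a
    diagram is a sum, over the values at the boundary of a tangle, of products
    of two counts, inside and outside. So R is unchanged by a move as soon as
    the two tangles have the same formal sum of tables of inside counts, where
    2^k times a table is identified with delta^k times that table; this is a
    finite computation for each move. A singular crossing contributes the sum of
    the contributions of the two classical crossings. *)

(** * Weight maps of tangles *)

(* What a resolved tangle says about a weight map: its junctions, and the pairs of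
   edges meeting at its virtual crossings. *)
Definition piece := (seq (nat * nat * bool) * seq (nat * nat))%type.
Definition pcat (P Q : piece) : piece := (P.1 ++ Q.1, P.2 ++ Q.2).
Definition prelab (f : nat -> nat) (P : piece) : piece :=
  ([seq (f j.1.1, f j.1.2, j.2) | j <- P.1], [seq (f v.1, f v.2) | v <- P.2]).
Definition res (c : crossing) (b : bool) : piece :=
  (junctions c b, if is_virt c then [:: (i1 c, i2 c)] else [::]).
(** What remains after a move that removes its crossings. The two ends of a strand are still
    distinct labels with an equality between them; [join] merges them later. *)
Definition strands (ps : seq (nat * nat)) : piece :=
  ([seq (p, false) | p <- ps], [::]).
Definition plabs (P : piece) : seq nat :=
  flatten [seq [:: j.1.1; j.1.2] | j <- P.1] ++ flatten [seq [:: v.1; v.2] | v <- P.2].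

Definition jsat (t : nat -> bool) (j : nat * nat * bool) : bool :=
  (t j.1.1 == t j.1.2) == ~~ j.2.
Definition vpar (t : nat -> bool) (V : seq (nat * nat)) : bool :=
  foldr (fun v b => (t v.1 != t v.2) (+) b) false V.
(* [t] is a weight map of [P], and the product of the i_t(v) is [(-1)^e]. *)
Definition has_sign (P : piece) (t : nat -> bool) (e : bool) : bool :=
  all (jsat t) P.1 && (vpar t P.2 == e).

(* [(b, e)] stands for [(-1)^b A^e]. *)
Definition mono := (bool * int)%type.
Definition mmul (m m' : mono) : mono := (m.1 (+) m'.1, (m.2 + m'.2)%R).

(* The resolutions of a crossing and their weights, the sign [(-1)^c(D)] being included.
   For a singular crossing these are the terms of the two classical crossings:
   [-A^2 - A^-2] and [-A^4 - A^-4] are split into their monomials. *)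
Definition opts (c : crossing) : seq (mono * bool) :=
  let pos := [:: ((true, (-2)%Z), true); ((true, (-4)%Z), false)] in
  let neg := [:: ((true, 2%Z), true); ((true, 4%Z), false)] in
  match ck c with
  | Pos => pos
  | Neg => neg
  | Sing => pos ++ neg
  | Virt => [:: ((false, 0%Z), true)]
  end.

Fixpoint terms (cs : seq crossing) : seq (mono * piece) :=
  if cs is c :: cs' then
    [seq (mmul mb.1 t.1, pcat (res c mb.2) t.2) | mb <- opts c, t <- terms cs']
  else [:: ((false, 0%Z), ([::], [::]))].

Fixpoint bools (n : nat) : seq (seq bool) :=
  if n is n'.+1 then [seq b :: v | b <- [:: false; true], v <- bools n'] else [:: [::]].

Definition tabdom (nb : nat) : seq (seq bool * bool) :=
  [seq (b, e) | b <- bools nb, e <- [:: false; true]].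
(* In a local picture the ends on the boundary are numbered from 0 to [nb - 1], and the
   inner edges from [nb] to [nb + nin - 1]. *)
Definition tabval (nin : nat) (P : piece) (b : seq bool) (e : bool) : nat :=
  count (fun v => has_sign P (nth false (b ++ v)) e) (bools nin).
Definition tab (nb nin : nat) (P : piece) : seq nat :=
  [seq tabval nin P be.1 be.2 | be <- tabdom nb].

Fixpoint dpow (k : nat) : seq mono :=
  if k is k'.+1 then [seq mmul m m' | m <- [:: (true, 2%Z); (true, (-2)%Z)], m' <- dpow k']
  else [:: (false, 0%Z)].

(** If the nonzero entries of a table all equal one power of 2, dividing by it leaves a table of
    zeros and ones, so proportional tables get the same key. *)
Definition maxlog (l : seq nat) : nat := trunc_log 2 (foldr maxn 0 l).

(* A table [2 ^ k * key] is replaced by [loop_value ^ k] times [key]. *)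
Definition formal (nb nin : nat) (t : mono * piece) : seq (mono * seq nat) :=
  let l := tab nb nin t.2 in
  let k := maxlog l in
  let key := [seq x %/ 2 ^ k | x <- l] in
  [seq (mmul t.1 m, key) | m <- dpow k].

Definition formal_ok (nb nin : nat) (t : mono * piece) : bool :=
  let l := tab nb nin t.2 in
  let k := maxlog l in
  all (fun x => 2 ^ k %| x) l && all (fun i => i < nb + nin) (plabs t.2).

Definition opp_term (t : mono * seq nat) : mono * seq nat := ((~~ t.1.1, t.1.2), t.2).
(** Folded over a list, this cancels opposite terms. An empty result proves that the sum vanishes
    whatever values the keys take. *)
Definition insert_term (t : mono * seq nat) (L : seq (mono * seq nat)) :=
  if opp_term t \in L then rem (opp_term t) L else t :: L.

Definition local_check (nb nin nin' : nat) (ts ts' : seq (mono * piece)) : bool :=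
  [&& all (formal_ok nb nin) ts, all (formal_ok nb nin') ts' &
   nilp (foldr insert_term [::]
     (flatten [seq formal nb nin t | t <- ts] ++
      [seq opp_term t | t <- flatten [seq formal nb nin' t | t <- ts']]))].
Definition sterm (ps : seq (nat * nat)) : seq (mono * piece) := [:: ((false, 0%Z), strands ps)].

Definition ext (M : nat) (t : {ffun 'I_M -> bool}) (n : nat) : bool :=
  if insub n is Some i then t i else false.
(* Labels range over ['I_M]: each label below [M] not used by [P] contributes a factor 2. *)
Definition wcount (M : nat) (P : piece) (e : bool) : nat :=
  \sum_(t : {ffun 'I_M -> bool}) has_sign P (ext t) e.

Local Open Scope ring_scope.

Definition loop_value (K : fieldType) (A : K) : K := - A ^+ 2 - A ^- 2.
Definition mono_eval (K : fieldType) (A : K) (m : mono) : K := (-1) ^+ m.1 * A ^ m.2.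
(* On the counts [N] of weight maps by sign, this is delta^||S|| h^((1-i(S))/2) up to the
   factor coming from the unused labels. *)
Definition count_weight (K : fieldType) (A h : K) (N : bool -> nat) : K :=
  if (N false + N true == 0)%N then 0
  else loop_value A ^+ trunc_log 2 (N false + N true) * (if N true == 0%N then 1 else h).

(** * Weights of counts and formal sums *)

Lemma trunc_log_scale k n : (0 < n)%N -> trunc_log 2 (2 ^ k * n) = (k + trunc_log 2 n)%N.
Proof.
move=> n0; elim: k => [|k IH]; first by rewrite expn0 mul1n.
rewrite expnS -mulnA mul2n trunc_log2_double ?IH //.
by rewrite muln_gt0 expn_gt0.
Qed.

Lemma count_weight_ext (K : fieldType) (A h : K) N N' : N =1 N' -> count_weight A h N = count_weight A h N'.
Proof. by move=> eN; rewrite /count_weight !eN. Qed.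

(** This trades 2 for delta. A positive count has its logarithm shifted by [k]; for a zero count
    both sides vanish by the convention in [count_weight]. *)
Lemma count_weight_scale (K : fieldType) (A h : K) k (N N' : bool -> nat) :
  (forall e, N e = 2 ^ k * N' e)%N -> count_weight A h N = loop_value A ^+ k * count_weight A h N'.
Proof.
move=> eN; rewrite /count_weight !eN -mulnDr !muln_eq0 expn_eq0 /=.
case: (posnP (N' false + N' true)%N) => [|n0]; first by rewrite mulr0.
by rewrite trunc_log_scale // exprD mulrA.
Qed.

Lemma mono_evalM (K : fieldType) (A : K) (A0 : A != 0) m m' :
  mono_eval A (mmul m m') = mono_eval A m * mono_eval A m'.
Proof. by rewrite /mono_eval /mmul /= signr_addb expfzDr // mulrACA. Qed.

Lemma mono_eval_opp (K : fieldType) (A : K) m : mono_eval A (~~ m.1, m.2) = - mono_eval A m.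
Proof. by rewrite /mono_eval /= signrN mulNr. Qed.

Lemma mono_eval_dpow (K : fieldType) (A : K) (A0 : A != 0) k :
  \sum_(m <- dpow k) mono_eval A m = loop_value A ^+ k.
Proof.
elim: k => [|k IH]; first by rewrite big_seq1 /mono_eval expr0 mul1r expr0z.
rewrite [dpow _.+1]/(allpairs _ _ _) big_allpairs_dep exprS -IH mulr_sumr.
rewrite big_cons big_seq1 /= -big_split; apply: eq_bigr => m _ /=.
rewrite !mono_evalM // -mulrDl; congr (_ * _).
rewrite /mono_eval /= expr1 !mulN1r /loop_value; congr (_ - _).
Qed.

Lemma big_insert_term (K : zmodType) (g : mono * seq nat -> K)
    (gN : forall t, g (opp_term t) = - g t) L :
  \sum_(t <- foldr insert_term [::] L) g t = \sum_(t <- L) g t.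
Proof.
elim: L => //= t L IH; rewrite big_cons -IH /insert_term.
case: ifP => [tin|_]; last by rewrite big_cons.
by rewrite [in RHS](big_rem _ tin) /= gN addNKr.
Qed.

(** The diagram seen from outside the tangle, which enters only through [key]. The maps [t] also run
    over the inner labels; when these are fresh nothing depends on them, whence the factor [2 ^ nin]
    of [wcount_local]. *)
Definition glue (M nb : nat) (f : nat -> nat) (P0 : piece) (key : seq nat) (e : bool) : nat :=
  (\sum_(t : {ffun 'I_M -> bool}) \sum_(e0 : bool)
    has_sign P0 (ext t) e0 *
    nth 0 key (index ([seq ext t (f i) | i <- iota 0 nb], e (+) e0) (tabdom nb)))%N.

Lemma mem_bools n v : (v \in bools n) = (size v == n).
Proof.
elim: n v => [|n IH] [|b v] //; first by apply/negbTE/allpairsP => -[? []].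
apply/allpairsP/idP => /= [[[b' v'] /= [_ v'in [_ ->]]]|sv].
  by rewrite eqSS -IH.
by exists (b, v) => /=; rewrite IH; split=> //; clear; case: b.
Qed.

Lemma mem_tabdom nb b e : ((b, e) \in tabdom nb) = (size b == nb).
Proof.
rewrite -mem_bools; apply/allpairsP/idP => /= [[[b' v'] /= [? _ [-> _]]] //|bin].
by exists (b, e); split=> //; clear; case: e.
Qed.

Lemma nth_tab nb nin P b e : size b = nb ->
  nth 0%N (tab nb nin P) (index (b, e) (tabdom nb)) = tabval nin P b e.
Proof.
move=> sb; have bin : (b, e) \in tabdom nb by rewrite mem_tabdom sb.
by rewrite (nth_map ([::], false)) ?index_mem // nth_index.
Qed.

Lemma vpar_cat t V V' : vpar t (V ++ V') = vpar t V (+) vpar t V'.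
Proof. by elim: V => //= v V ->; rewrite addbA. Qed.

Lemma has_sign_pcat P Q t e :
  has_sign (pcat P Q) t e = (\sum_(e0 : bool) has_sign P t e0 * has_sign Q t (e (+) e0))%N :> nat.
Proof.
rewrite big_bool /has_sign /= all_cat vpar_cat.
by case: (all _ P.1); case: (all _ Q.1); case: (vpar t P.2); case: (vpar t Q.2); case: e.
Qed.

Lemma has_sign_prelab f P t e : has_sign (prelab f P) t e = has_sign P (t \o f) e.
Proof.
rewrite /has_sign /prelab /= all_map; congr (_ && _); congr (_ == _).
by elim: P.2 => //= v V ->.
Qed.

Lemma has_sign_eq P t t' e : {in plabs P, t =1 t'} -> has_sign P t e = has_sign P t' e.
Proof.
case: P => J V; rewrite /plabs /has_sign /= => tt'.
have {}tt' x : (x \in flatten [seq [:: j.1.1; j.1.2] | j <- J]) ||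
    (x \in flatten [seq [:: v.1; v.2] | v <- V]) -> t x = t' x.
  by move=> xin; apply: tt'; rewrite mem_cat.
congr (_ && _); last congr (_ == _).
  apply: eq_in_all => j jJ; rewrite /jsat.
  by rewrite !tt' //; apply/orP; left; apply/flatten_mapP; exists j; rewrite // !inE eqxx ?orbT.
have {}tt' x : (x \in flatten [seq [:: v.1; v.2] | v <- V]) -> t x = t' x.
  by move=> xin; apply: tt'; rewrite xin orbT.
elim: V tt' => //= v V IH tt'.
rewrite !(tt' v.1, tt' v.2) ?inE ?eqxx ?orbT //; congr (_ (+) _).
by apply: IH => x xin; apply: tt'; rewrite !inE xin !orbT.
Qed.

Definition setb (t : nat -> bool) (l : nat) (b : bool) : nat -> bool :=
  fun x => if x == l then b else t x.
Definition flipl (M : nat) (l : nat) (t : {ffun 'I_M -> bool}) : {ffun 'I_M -> bool} :=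
  [ffun i : 'I_M => if i == l :> nat then ~~ t i else t i].

Lemma ext_flipl M l (t : {ffun 'I_M -> bool}) : (l < M)%N ->
  ext (flipl l t) = setb (ext t) l (~~ ext t l).
Proof.
move=> lM; apply: functional_extensionality => x; rewrite /ext /setb.
case: insubP => [i _ <-|nx].
  rewrite ffunE; case: eqP => // <-.
  by case: insubP => [j _ /val_inj -> //|]; rewrite ltn_ord.
by case: eqP => // xl; rewrite xl lM in nx.
Qed.

Lemma setb_id t l : setb t l (t l) = t.
Proof. by apply: functional_extensionality => x; rewrite /setb; case: eqP => // ->. Qed.

(** The two values at [l] are those of [t] and of its flip at [l], and flipping permutes the
    maps. *)
Lemma sum_setb M l (F : (nat -> bool) -> nat) : (l < M)%N ->
  (2 * \sum_(t : {ffun 'I_M -> bool}) F (ext t) =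
   \sum_(t : {ffun 'I_M -> bool}) \sum_(b : bool) F (setb (ext t) l b))%N.
Proof.
move=> lM; rewrite mul2n -addnn.
have fK : involutive (@flipl M l).
  by move=> t; apply/ffunP => i; rewrite !ffunE; case: eqP => // _; rewrite negbK.
rewrite [X in (_ + X = _)%N](reindex_inj (inv_inj fK)) -big_split /=.
apply: eq_bigr => t _; rewrite ext_flipl // -{1}(setb_id (ext t) l) big_bool.
by case: (ext t l); rewrite // addnC.
Qed.

Fixpoint upd (t : nat -> bool) (ls : seq nat) (v : seq bool) : nat -> bool :=
  if ls is l :: ls' then upd (setb t l (head false v)) ls' (behead v) else t.

Lemma sum_upd M ls (F : (nat -> bool) -> nat) : all (fun l => l < M)%N ls ->
  (2 ^ size ls * \sum_(t : {ffun 'I_M -> bool}) F (ext t) =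
   \sum_(t : {ffun 'I_M -> bool}) \sum_(v <- bools (size ls)) F (upd (ext t) ls v))%N.
Proof.
elim: ls F => [|l ls IH] F /=.
  by rewrite mul1n => _; apply: eq_bigr => t _; rewrite big_seq1.
case/andP=> lM lsM; rewrite expnS -mulnA (IH _ lsM).
rewrite (sum_setb (fun t => \sum_(v <- bools (size ls)) F (upd t ls v))%N lM).
apply: eq_bigr => t _.
by rewrite cats0 big_cat !big_map big_bool /= addnC.
Qed.

Lemma upd_notin t ls v x : x \notin ls -> upd t ls v x = t x.
Proof.
elim: ls t v => //= l ls IH t v; rewrite inE negb_or => /andP[xl xls].
by rewrite IH // /setb (negbTE xl).
Qed.

Lemma upd_nth t ls v i : uniq ls -> (i < size ls)%N ->
  upd t ls v (nth 0%N ls i) = nth false v i.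
Proof.
elim: ls t v i => //= l ls IH t v [|i] /andP[lls uls]; rewrite ?ltnS => si /=.
  by rewrite upd_notin // /setb eqxx; case: v.
by rewrite IH // nth_behead.
Qed.

(** Injectivity is asked only of pairs containing an inner label: two boundary ends share a label
    when an edge joins them outside the tangle. *)
Definition fresh_inner (M nb nin : nat) (f : nat -> nat) (P0 : piece) : Prop :=
  [/\ forall i, (i < nb + nin)%N -> (f i < M)%N,
      forall i j, (nb <= i < nb + nin)%N -> (j < nb + nin)%N -> f i = f j -> i = j &
      forall i, (nb <= i < nb + nin)%N -> f i \notin plabs P0].

(** Overwriting the inner labels by all values [v] multiplies the count by [2 ^ nin]. For fixed [t]
    the outer factor does not see [v], and the inner one summed over [v] is the table entry at the
    boundary values of [t]. *)
Lemma wcount_local M nb nin f P0 P e : fresh_inner M nb nin f P0 ->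
    all (fun i => i < nb + nin)%N (plabs P) ->
  (2 ^ nin * wcount M (pcat P0 (prelab f P)) e = glue M nb f P0 (tab nb nin P) e)%N.
Proof.
move=> [fM finj fP0] /allP Pidx.
pose ls := [seq f i | i <- iota nb nin].
have sls : size ls = nin by rewrite size_map size_iota.
have lsM : all (fun l => l < M)%N ls.
  apply/allP => x /mapP[i]; rewrite mem_iota => /andP[_ ilt] ->; exact: fM.
have uls : uniq ls.
  rewrite map_inj_in_uniq ?iota_uniq // => i j; rewrite !mem_iota => ii /andP[_ jj] fij.
  exact: (finj i j).
rewrite -[in (2 ^ nin)%N]sls (sum_upd (fun t => has_sign (pcat P0 (prelab f P)) t e : nat) lsM) sls.
apply: eq_bigr => t _.
transitivity (\sum_(v <- bools nin) \sum_(e0 : bool)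
   has_sign P0 (ext t) e0 * has_sign P (nth false ([seq ext t (f i) | i <- iota 0 nb] ++ v)) (e (+) e0))%N.
  rewrite big_seq [RHS]big_seq; apply: eq_bigr => v; rewrite mem_bools => /eqP sv.
  rewrite has_sign_pcat; apply: eq_bigr => e0 _; congr (nat_of_bool _ * nat_of_bool _)%N.
    apply: has_sign_eq => x xP0; apply: upd_notin; apply/mapP => -[i]; rewrite mem_iota => ii xi.
    by move: (fP0 i ii); rewrite -xi xP0.
  rewrite has_sign_prelab; apply: has_sign_eq => i /Pidx ilt /=.
  rewrite nth_cat size_map size_iota; case: ltnP => inb.
    rewrite (nth_map 0%N) ?size_iota // nth_iota // add0n upd_notin //.
    apply/mapP => -[j]; rewrite mem_iota => jj fij.
    have ji := finj j i jj ilt (esym fij).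
    by move: jj; rewrite ji leqNgt inb.
  have ilt' : (i - nb < nin)%N by rewrite ltn_subLR.
  rewrite -(upd_nth (ext t) v uls) ?sls //.
  by rewrite (nth_map 0%N) ?size_iota // nth_iota // subnKC.
rewrite exchange_big /=; apply: eq_bigr => e0 _.
rewrite -big_distrr /= nth_tab ?size_map ?size_iota //; congr (_ * _)%N.
by rewrite /tabval -sum1_count [RHS]big_mkcond; apply: eq_bigr => v _; case: has_sign.
Qed.

Lemma glue_scale M nb f P0 k key key' e :
    (forall i, nth 0 key i = 2 ^ k * nth 0 key' i)%N ->
  (glue M nb f P0 key e = 2 ^ k * glue M nb f P0 key' e)%N.
Proof.
move=> nk; rewrite /glue big_distrr; apply: eq_bigr => t _.
by rewrite big_distrr; apply: eq_bigr => e0 _; rewrite nk mulnCA.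
Qed.

Lemma formalE (K : fieldType) (A h : K) (A0 : A != 0) M nb nin f P0 t :
    fresh_inner M nb nin f P0 -> formal_ok nb nin t ->
  loop_value A ^+ nin * (mono_eval A t.1 * count_weight A h (wcount M (pcat P0 (prelab f t.2)))) =
  \sum_(mk <- formal nb nin t) mono_eval A mk.1 * count_weight A h (glue M nb f P0 mk.2).
Proof.
move=> fr /andP[/allP dv idx]; rewrite mulrCA.
rewrite -(count_weight_scale A h (fun e => esym (wcount_local e fr idx))).
rewrite /formal big_map /=; set l := tab _ _ _; set k := maxlog l.
set key := [seq (x %/ 2 ^ k)%N | x <- l].
have -> : count_weight A h (glue M nb f P0 l) = loop_value A ^+ k * count_weight A h (glue M nb f P0 key).
  apply: count_weight_scale => e; apply: glue_scale => i; case: (ltnP i (size l)) => il; last first.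
    by rewrite !nth_default ?muln0 // /key size_map.
  by rewrite (nth_map 0%N) // mulnC divnK // dv // mem_nth.
rewrite -(mono_eval_dpow A0) mulr_suml mulr_sumr; apply: eq_bigr => m _.
by rewrite mono_evalM // mulrA.
Qed.

(** Since [f] and [f'] agree on the boundary, both tangles are glued to the outside in the same way,
    and the cancellation of formal terms becomes an identity of weights. *)
Lemma local_check_sound (K : fieldType) (A h : K) (A0 : A != 0) M nb nin nin' f f' P0 ts ts' :
    local_check nb nin nin' ts ts' ->
    {in iota 0 nb, f =1 f'} ->
    fresh_inner M nb nin f P0 -> fresh_inner M nb nin' f' P0 ->
  loop_value A ^+ nin * \sum_(t <- ts) mono_eval A t.1 * count_weight A h (wcount M (pcat P0 (prelab f t.2))) =
  loop_value A ^+ nin' * \sum_(t <- ts') mono_eval A t.1 * count_weight A h (wcount M (pcat P0 (prelab f' t.2))).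
Proof.
move=> /and3P[/allP ok /allP ok' /nilP nil] ff' fr fr'.
have glueE key : glue M nb f P0 key =1 glue M nb f' P0 key.
  move=> e; apply: eq_bigr => t _; apply: eq_bigr => e0 _.
  by congr (_ * nth _ _ (index (_, _) _))%N; apply/eq_in_map => i /ff' ->.
pose g (mk : mono * seq nat) := mono_eval A mk.1 * count_weight A h (glue M nb f P0 mk.2).
have gN mk : g (opp_term mk) = - g mk by rewrite /g mono_eval_opp mulNr.
rewrite !mulr_sumr; apply/eqP; rewrite -subr_eq0; apply/eqP.
transitivity (\sum_(mk <- [::]) g mk); last by rewrite big_nil.
rewrite -nil big_insert_term // big_cat /=; congr (_ + _).
  rewrite big_flatten big_map big_seq [RHS]big_seq; apply: eq_bigr => t /ok okt.
  exact: formalE.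
rewrite big_map big_flatten big_map -sumrN big_seq [RHS]big_seq; apply: eq_bigr => t /ok' okt.
rewrite (formalE h A0 fr' okt) -sumrN; apply: eq_bigr => mk _.
by rewrite gN /g (count_weight_ext _ _ (glueE _)).
Qed.

(** * Expansion of a list of crossings into resolutions *)

Definition term_sum (K : fieldType) (A : K) (cs : seq crossing) (F : piece -> K) : K :=
  \sum_(t <- terms cs) mono_eval A t.1 * F t.2.

Lemma term_sum_nil (K : fieldType) (A : K) F : term_sum A [::] F = F ([::], [::]).
Proof. by rewrite /term_sum big_seq1 /mono_eval expr0 expr0z !mul1r. Qed.

Lemma term_sum_cons (K : fieldType) (A : K) (A0 : A != 0) c cs F :
  term_sum A (c :: cs) F = \sum_(mb <- opts c) mono_eval A mb.1 * term_sum A cs (fun P => F (pcat (res c mb.2) P)).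
Proof.
rewrite /term_sum [terms _]/(allpairs _ _ _) big_allpairs_dep; apply: eq_bigr => mb _.
by rewrite mulr_sumr; apply: eq_bigr => t _; rewrite mono_evalM // mulrA.
Qed.

Lemma term_sum_eq (K : fieldType) (A : K) cs F G : F =1 G -> term_sum A cs F = term_sum A cs G.
Proof. by move=> FG; apply: eq_bigr => t _; rewrite FG. Qed.

Lemma pcatA P Q S : pcat P (pcat Q S) = pcat (pcat P Q) S.
Proof. by rewrite /pcat /= !catA. Qed.

Lemma term_sum_cat (K : fieldType) (A : K) (A0 : A != 0) cs ds F :
  term_sum A (cs ++ ds) F = term_sum A cs (fun P => term_sum A ds (fun Q => F (pcat P Q))).
Proof.
elim: cs F => [|c cs IH] F /=.
  by rewrite term_sum_nil; apply: term_sum_eq => -[].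
rewrite !term_sum_cons //; apply: eq_bigr => mb _; rewrite IH; congr (_ * _).
by apply: term_sum_eq => P; apply: term_sum_eq => Q; rewrite pcatA.
Qed.

Lemma has_sign_pcatb P Q t e :
  has_sign (pcat P Q) t e = (has_sign P t true && has_sign Q t (~~ e)) || (has_sign P t false && has_sign Q t e).
Proof.
have := has_sign_pcat P Q t e; rewrite big_bool addbT addbF /=.
by do 5!case: (has_sign _ _ _).
Qed.

(** Reordering crossings only permutes the junctions and the virtual crossings, which [has_sign]
    does not see; hence the condition on [F]. *)
Lemma term_sum_perm (K : fieldType) (A : K) (A0 : A != 0) cs ds F :
    Permutation.Permutation cs ds -> (forall P Q, has_sign P =2 has_sign Q -> F P = F Q) ->
  term_sum A cs F = term_sum A ds F.
Proof.
move=> cd; elim: cd F => [|c {}cs {}ds _ IH|c d es|{}cs es {}ds _ IH1 _ IH2] F FP //.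
- rewrite !term_sum_cons //; apply: eq_bigr => mb _; congr (_ * _); apply: IH => P Q PQ.
  by apply: FP => t e; rewrite !has_sign_pcatb !PQ.
- rewrite !term_sum_cons // (eq_bigr _ (fun mb _ => congr1 _ (term_sum_cons A0 _ _ _))).
  rewrite [RHS](eq_bigr _ (fun mb _ => congr1 _ (term_sum_cons A0 _ _ _))).
  rewrite (eq_bigr _ (fun mb _ => mulr_sumr _ _ _ _)).
  rewrite [RHS](eq_bigr _ (fun mb _ => mulr_sumr _ _ _ _)) exchange_big /=.
  apply: eq_bigr => mb _; apply: eq_bigr => mb' _; rewrite mulrCA.
  congr (_ * (_ * _)); apply: term_sum_eq => P; apply: FP => t e.
  by rewrite /has_sign /pcat /= !all_cat !vpar_cat andbCA addbCA.
- by rewrite IH1 // IH2.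
Qed.

Lemma term_sum_relab (K : fieldType) (A : K) (A0 : A != 0) f cs F :
  term_sum A (map (relab f) cs) F = term_sum A cs (fun P => F (prelab f P)).
Proof.
elim: cs F => [|c cs IH] F; first by rewrite !term_sum_nil.
rewrite /= !term_sum_cons //; have -> : opts (relab f c) = opts c by [].
apply: eq_bigr => mb _; rewrite IH; congr (_ * _); apply: term_sum_eq => P; congr F.
rewrite /pcat /prelab /= !map_cat; congr (_, _); congr (_ ++ _).
  by rewrite /junctions /relab /is_virt; case: (ck c); case: mb.2.
by rewrite /is_virt /=; case: (ck c).
Qed.

(* Reconnecting strands and relabelling edges *)
Local Close Scope ring_scope.

(** An equality between two distinct labels halves the number of maps, and merging the labels solves
    it. An equality of a label with itself is no constraint, and the factor 2 left over accounts for
    the new free loop. *)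
Lemma join_count M (F : (nat -> bool) -> nat) ps s l :
    (forall x, x < M -> s x < M) -> all (fun p => (p.1 < M) && (p.2 < M)) ps ->
  2 ^ (size ps + l) * (\sum_(t : {ffun 'I_M -> bool})
      all (fun p => ext t (s p.1) == ext t (s p.2)) ps * F (ext t \o s)) =
  2 ^ (join ps s l).2 * \sum_(t : {ffun 'I_M -> bool}) F (ext t \o (join ps s l).1).
Proof.
elim: ps s l => [|[u w] ps IH] s l sM /=.
  by rewrite add0n => _; congr (_ * _); apply: eq_bigr => t _; rewrite mul1n.
case/andP=> /andP[uM wM] psM; case: eqP => [uw|/eqP uw].
  rewrite -IH // addnS addSn; congr (_ * _); apply: eq_bigr => t _.
  by rewrite uw eqxx.
have s1M x : x < M -> (if s x == s w then s u else s x) < M.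
  by case: ifP => _; [move=> _; apply: sM|apply: sM].
rewrite -IH // addSn expnSr -mulnA; congr (_ * _).
pose G t : nat := ((t (s u) == t (s w)) && all (fun p => t (s p.1) == t (s p.2)) ps) * F (t \o s).
rewrite [LHS](_ : _ = 2 * \sum_(t : {ffun 'I_M -> bool}) G (ext t)) // (sum_setb _ (sM w wM)).
apply: eq_bigr => t _; set rhs := (X in _ = X).
have GE b : G (setb (ext t) (s w) b) = (ext t (s u) == b) * rhs.
  rewrite /G {1 2}/setb (negbTE uw) eqxx; case: eqP => //= <-.
  have -> : setb (ext t) (s w) (ext t (s u)) \o s =
      ext t \o (fun x => if s x == s w then s u else s x).
    by apply: functional_extensionality => x; rewrite /setb /=; case: eqP.
  rewrite mul1n /rhs; congr (nat_of_bool _ * _); apply: eq_all => p.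
  by rewrite /setb; case: (s p.1 == s w); case: (s p.2 == s w).
by rewrite big_bool /= !GE; case: (ext t (s u)); rewrite !(mul0n, mul1n, addn0).
Qed.

Lemma has_sign_strands ps t e :
  has_sign (strands ps) t e = all (fun p => t p.1 == t p.2) ps && ~~ e.
Proof.
rewrite /has_sign /strands /= all_map; congr (_ && _).
by apply: eq_all => p; rewrite /jsat /= eqb_id.
Qed.

Lemma wcount_strands M P ps e : all (fun p => (p.1 < M) && (p.2 < M)) ps ->
  2 ^ size ps * wcount M (pcat P (strands ps)) e =
  2 ^ (join ps id 0).2 * wcount M (prelab (join ps id 0).1 P) e.
Proof.
move=> psM.
have := @join_count M (fun t => has_sign P t e : nat) ps id 0 (fun x => id) psM.
rewrite addn0 => E; transitivity (2 ^ (join ps id 0).2 *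
  (\sum_(t : {ffun 'I_M -> bool}) has_sign P (ext t \o (join ps id 0).1) e)); last first.
  by congr (_ * _); apply: eq_bigr => t _; rewrite has_sign_prelab.
rewrite -E; congr (_ * _); apply: eq_bigr => t _.
rewrite has_sign_pcatb !has_sign_strands /= negbK.
have -> : ext t \o id = ext t by [].
case: all; rewrite ?andbF ?andbT //= mul1n.
by case: e {E}; rewrite ?andbF ?andbT ?orbF //; case: has_sign.
Qed.

Definition lext (L : seq nat) (v : seq bool) (x : nat) : bool := nth false v (index x L).

(** Once the labels of [L] are overwritten, the summand no longer depends on [t], and there are
    [2 ^ M] maps [t]. *)
Lemma sum_lext M L (F : (nat -> bool) -> nat) : uniq L -> all (fun x => x < M) L ->
    (forall t t', {in L, t =1 t'} -> F t = F t') ->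
  2 ^ size L * (\sum_(t : {ffun 'I_M -> bool}) F (ext t)) =
  2 ^ M * \sum_(v <- bools (size L)) F (lext L v).
Proof.
move=> uL LM FL; rewrite sum_upd //.
rewrite [LHS](eq_bigr (fun=> \sum_(v <- bools (size L)) F (lext L v))) => [|t _].
  have := sum_nat_const {: {ffun 'I_M -> bool}} (\sum_(v <- bools (size L)) F (lext L v)).
  by rewrite card_ffun card_bool card_ord => <-.
apply: eq_bigr => v _; apply: FL => x xL.
by rewrite -{1}(nth_index 0 xL) upd_nth ?index_mem.
Qed.

Lemma plabs_prelab f P : plabs (prelab f P) = map f (plabs P).
Proof.
case: P => J V; rewrite /plabs /prelab /= map_cat; congr (_ ++ _).
  by elim: J => //= j J ->.
by elim: V => //= v V ->.
Qed.

(** As [f] need not preserve the set of labels below [M], both counts are compared with the count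
    over the labels that occur. *)
Lemma wcount_relab M f P e : injective f ->
    all (fun x => (x < M) && (f x < M)) (plabs P) ->
  wcount M (prelab f P) e = wcount M P e.
Proof.
move=> finj /allP PM; pose L := undup (plabs P).
apply/eqP; rewrite -(eqn_pmul2l (expn_gt0 2 (size L))); apply/eqP.
have uL : uniq L by exact: undup_uniq.
have memL x : x \in plabs P -> x \in L by rewrite mem_undup.
rewrite /wcount (@sum_lext M L (fun t => has_sign P t e : nat)) //; first last.
- by move=> t t' tt'; rewrite (@has_sign_eq P t t') // => x /memL /tt'.
- by apply/allP => x; rewrite mem_undup => /PM /andP[].
rewrite -(size_map f) (@sum_lext M (map f L) (fun t => has_sign (prelab f P) t e : nat)).
- rewrite size_map; congr (_ * _); apply: eq_bigr => v _; rewrite has_sign_prelab; congr nat_of_bool.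
  by apply: has_sign_eq => x _; rewrite /lext /= index_map.
- by rewrite map_inj_uniq.
- by apply/allP => _ /mapP[x xL ->]; move: xL; rewrite mem_undup => /PM /andP[].
move=> t t' tt'; rewrite (@has_sign_eq _ t t') // => x; rewrite plabs_prelab => /mapP[y /memL yL ->].
by apply: tt'; apply: map_f.
Qed.

(** * Counting weight maps *)

Lemma alternating_exists (T : finType) (a p : T -> T) :
    involutive a -> involutive p -> (forall x, a x != x) -> (forall x, p x != x) ->
  exists H : T -> bool, forall x, H (a x) = ~~ H x /\ H (p x) = ~~ H x.
Proof.
(* [a] exchanges the two orbits of [p \o a] that make up a component *)
move=> aK pK a_neq p_neq; pose g x := p (a x).
have gI : injective g by move=> x y /(inv_inj pK) /(inv_inj aK).
have gsym := fconnect_sym gI.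
(* For [n > 1], [g^n y = a y] gives [g^(n-2) (g y) = a (g y)]; the descent ends at a fixed point of
   [a] or of [p]. *)
have no_half n y : iter n g y != a y.
  elim/ltn_ind: n y => -[|[|n]] IH y; first by rewrite eq_sym.
    exact: p_neq.
  apply/eqP; rewrite iterS iterSr => E.
  have /eqP[] := IH n (leqnSn _) (g y).
  by apply: gI; rewrite E /g aK pK.
have disj y r : fconnect g r y -> fconnect g r (a y) -> False.
  move=> ry ray; have : fconnect g y (a y) by rewrite (connect_trans _ ray) // gsym.
  by case/iter_findex/eqP; rewrite (negbTE (no_half _ _)).
pose e := [rel x y | (y == a x) || (y == p x)].
have e_sym : connect_sym e.
  by apply: sym_connect_sym => x y /=; rewrite ![y == _]eq_sym (can2_eq aK aK) (can2_eq pK pK).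
have cover r y : connect e r y -> fconnect g r y || fconnect g r (a y).
  case/connectP => q; elim/last_ind: q y => [|q z IH] y; first by move=> _ ->; rewrite connect0.
  rewrite rcons_path last_rcons => /andP[/IH{}IH ez] ->.
  move: (IH _ erefl) ez; set w := last r q => {}IH /= /orP[] /eqP ->; first by rewrite aK orbC.
  case/orP: IH => rw; apply/orP.
    right; rewrite (connect_trans rw) // gsym; apply/connect1.
    by rewrite /= /g aK pK.
  by left; rewrite (connect_trans rw) //; apply/connect1; rewrite /= /g aK.
pose r x := fingraph.root e x.
have rK x y : e x y -> r y = r x.
  by move=> exy; apply/esym/eqP; rewrite (root_connect e_sym); apply: connect1.
have alt_a x : fconnect g (r x) (a x) = ~~ fconnect g (r x) x.
  have := cover (r x) x; rewrite e_sym connect_root => /(_ isT).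
  by case E: (fconnect g _ x) => /=; [move=> _; apply/negP => /(disj _ _ E)|].
exists (fun x => fconnect g (r x) x) => x; split.
  by rewrite (rK x) /= ?eqxx // alt_a.
rewrite (rK x) /= ?eqxx ?orbT // -alt_a.
have <- : g (a x) = p x by rewrite /g aK.
by rewrite -!(gsym _ (r x)) -(same_connect1 gsym (eqxx (g (a x)))).
Qed.

(** An invariant function amounts to the set of component roots at which it is true. *)
Lemma card_invariant (T : finType) (e : rel T) : connect_sym e ->
  #|[set f : {ffun T -> bool} | [forall x, forall y, e x y ==> (f x == f y)]]| = 2 ^ n_comp e T.
Proof.
move=> e_sym; pose phi (B : {set T}) := [ffun x => fingraph.root e x \in B].
pose Rt := [set x | roots e x].
have -> : [set f : {ffun T -> bool} | [forall x, forall y, e x y ==> (f x == f y)]] =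
    phi @: powerset Rt.
  apply/setP => f; rewrite inE; apply/idP/imsetP => [/forallP finv|[B _ ->]].
    exists [set x in Rt | f x]; first by rewrite inE; apply/subsetP => x; rewrite !inE => /andP[].
    apply/ffunP => x; rewrite ffunE !inE (roots_root e_sym) /=.
    have /connectP[q] := connect_root e x.
    elim: q x => [|y q IH] x /=; first by move=> _ ->.
    case/andP=> exy yq; rewrite (fingraph.rootP e_sym (connect1 exy)) => xq.
    by rewrite -(IH y yq xq); have /forallP/(_ y)/implyP/(_ exy)/eqP := finv x.
  apply/forallP => x; apply/forallP => y; apply/implyP => exy.
  by rewrite !ffunE (fingraph.rootP e_sym (connect1 exy)).
rewrite card_in_imset ?card_powerset.
  congr (2 ^ _); apply: eq_card => x.
  by rewrite !inE andbT.
move=> B C; rewrite !inE => /subsetP BR /subsetP CR /ffunP BC; apply/setP => x.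
have [xR|xR] := boolP (x \in Rt).
  by have := BC x; rewrite !ffunE; move: xR; rewrite inE => /eqP ->.
by rewrite (contraNF (BR x) xR) (contraNF (CR x) xR).
Qed.

Definition alternating (T : finType) (a p : T -> T) (H : T -> bool) : bool :=
  [forall x, (H (a x) == ~~ H x) && (H (p x) == ~~ H x)].

(** Adding a fixed alternating function mod 2 turns alternating functions into functions constant on
    the components of [e], which in the application are the closed curves of a state. *)
Lemma card_alternating (T : finType) (a p : T -> T) (e : rel T) :
    involutive a -> involutive p -> (forall x, a x != x) -> (forall x, p x != x) ->
    (forall x y, e x y = [|| y == a x, y == p x, x == a y | x == p y]) ->
  #|[set H : {ffun T -> bool} | alternating a p H]| = 2 ^ n_comp e T.
Proof.
move=> aK pK a_neq p_neq eE.
have [H0 H0alt] := alternating_exists aK pK a_neq p_neq.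
have e_sym : connect_sym e.
  apply: sym_connect_sym => x y; rewrite !eE.
  by do !case: (_ == _).
rewrite -(card_invariant e_sym).
pose phi (H : {ffun T -> bool}) := [ffun x => H x (+) H0 x].
have phiK : involutive phi by move=> H; apply/ffunP => x; rewrite !ffunE addbK.
rewrite -(card_imset _ (inv_inj phiK)); congr #|pred_of_set _|; apply/setP => H.
rewrite -{1}(phiK H) (mem_imset _ _ (inv_inj phiK)) !inE; apply/forallP/forallP => HH x.
  apply/forallP => y; apply/implyP; rewrite eE.
  have inv z : H (a z) = H z /\ H (p z) = H z.
    have := HH z; rewrite !ffunE; case: (H0alt z) => -> ->.
    by case: (H0 z); case: (H z); case: (H (a z)); case: (H (p z)).
  by case/or4P => /eqP ->; rewrite ?(inv _).1 ?(inv _).2.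
have inv z w : e z w -> H z = H w by move=> ezw; have /forallP/(_ w)/implyP/(_ ezw)/eqP := HH z.
rewrite !ffunE -(inv x (a x)) ?eE ?eqxx // -(inv x (p x)) ?eE ?eqxx ?orbT //.
by case: (H0alt x) => -> ->; case: (H0 x); case: (H x).
Qed.

(** * Weight maps as alternating functions on darts *)

Definition isout (D : diagram) (d : dart D) : bool := 1 < d.2.

Lemma size_flatten_pair (T U : Type) (g1 g2 : T -> U) cs :
  size (flatten [seq [:: g1 c; g2 c] | c <- cs]) = 2 * size cs.
Proof. by elim: cs => //= c cs ->; rewrite mulnS. Qed.

Lemma nth_flatten_pair (T U : Type) (x0 : U) (c0 : T) (g1 g2 : T -> U) cs k (b : bool) :
  k < size cs -> nth x0 (flatten [seq [:: g1 c; g2 c] | c <- cs]) (2 * k + b) =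
    (if b then g2 else g1) (nth c0 cs k).
Proof.
elim: cs k => //= c cs IH [|k]; first by clear IH; case: b.
by rewrite ltnS mulnS !addSn add0n /= => /IH ->.
Qed.

Lemma uniq_bools n : uniq (bools n).
Proof.
elim: n => // n IH; rewrite [bools _]/(allpairs _ _ _) allpairs_uniq //.
by move=> [b v] [b' v'] _ _ /= [-> ->].
Qed.

Section Darts.
Context (D : diagram).
Implicit Types (d : dart D).

Definition ends (o : bool) := if o then outs D else ins D.
Definition didx d := 2 * d.1 + odd d.2.

Lemma size_ins : size (ins D) = 2 * size (crs D).
Proof. exact: size_flatten_pair. Qed.
Lemma size_ends o : size (ends o) = 2 * size (crs D).
Proof. by case: o; exact: size_flatten_pair. Qed.

Lemma labE d : lab d = nth 0 (ends (isout d)) (didx d).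
Proof.
rewrite /lab /ends /isout /didx; case: d => k [[|[|[|[|j]]]] jlt] //=; apply/esym.
- exact: (nth_flatten_pair 0 dummy_cr i1 i2 false (ltn_ord k)).
- exact: (nth_flatten_pair 0 dummy_cr i1 i2 true (ltn_ord k)).
- exact: (nth_flatten_pair 0 dummy_cr o1 o2 false (ltn_ord k)).
- exact: (nth_flatten_pair 0 dummy_cr o1 o2 true (ltn_ord k)).
Qed.

Lemma didx_lt d : didx d < 2 * size (crs D).
Proof. by rewrite /didx; case: d => k j /=; have := ltn_ord k; case: odd; lia. Qed.

Lemma lab_mem d : lab d \in ends (isout d).
Proof. by rewrite labE mem_nth // size_ends didx_lt. Qed.

Lemma ends_lab o x : x \in ends o -> exists d, lab d = x /\ isout d = o.
Proof.
move=> /(nthP 0)[i]; rewrite size_ends => ilt <-.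
have klt : i./2 < size (crs D) by lia.
have jlt : odd i + 2 * o < 4 by case: o; case: odd.
exists (Ordinal klt, Ordinal jlt).
have out_o : isout (Ordinal klt, Ordinal jlt) = o by rewrite /isout /=; case: (o); case: odd.
split=> //; rewrite labE out_o /didx /=; congr nth.
by rewrite oddD oddM /= oddb addbF; lia.
Qed.

Context (wfD : wf D).
Let uniq_ends o : uniq (ends o).
Proof. by case/and3P: wfD; case: o. Qed.
Lemma mem_ends o o' : ends o =i ends o'.
Proof.
have /perm_mem E : perm_eq (ins D) (outs D) by case/and3P: wfD.
by case: o o' => [] [] x; rewrite ?E.
Qed.

Lemma lab_inj d d' : isout d = isout d' -> lab d = lab d' -> d = d'.
Proof.
move=> oo; rewrite !labE oo => /eqP; rewrite nth_uniq ?size_ends ?didx_lt // => /eqP.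
move: oo; rewrite /isout /didx; case: d d' => k j [k' j'] /= oo ii.
have jj : j = j' :> nat.
  by move: oo ii; have := ltn_ord j; have := ltn_ord j'; case: (j : nat) (j' : nat) =>
   [|[|[|[|?]]]] [|[|[|[|?]]]] //=; lia.
have kk : k = k' :> nat by move: ii; rewrite jj; lia.
by congr (_, _); apply: val_inj.
Qed.

(** In a well-formed diagram a label is used once as an incoming and once as an outgoing end, so
    [pick] has a single candidate, the other end of the edge. *)
Lemma alphaP d : lab (alpha d) = lab d /\ isout (alpha d) = ~~ isout d.
Proof.
have [d' [ld' od']] : exists d', lab d' = lab d /\ isout d' = ~~ isout d.
  by apply: ends_lab; rewrite (mem_ends _ (isout d)) lab_mem.
rewrite /alpha; case: pickP => [d1 /andP[d1d /eqP ld1]|/(_ d')] /=.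
  split=> //; have [oo|] := eqVneq (isout d1) (isout d); last by do 2!case: isout.
  by rewrite (lab_inj oo ld1) eqxx in d1d.
rewrite ld' eqxx andbT => /negbFE/eqP dd'.
by move: od'; rewrite dd'; case: isout.
Qed.

Lemma alpha_neq d : alpha d != d.
Proof. by apply/eqP => E; case: (alphaP d) => _; rewrite E; case: isout. Qed.

Lemma alphaK : involutive (@alpha D).
Proof.
move=> d; apply: lab_inj; last by rewrite !(alphaP _).1.
by rewrite !(alphaP _).2 negbK.
Qed.

Context (s : state D).

(* [t] relative to the orientation of the curves of the state: at a bivalent vertex both
   edges point the same way, so a weight map is a [t] for which this alternates. *)
Definition flow (t : nat -> bool) d := t (lab d) (+) isout d.

Lemma partner_lt c o j : j < 4 -> partner_slot c o j < 4.
Proof.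
rewrite /partner_slot; case: is_virt; first by rewrite ltn_mod.
by case: o; case: j => [|[|[|[|?]]]].
Qed.

Lemma partner_slotK c o j : j < 4 -> partner_slot c o (partner_slot c o j) = j.
Proof.
rewrite /partner_slot; case: is_virt; first by case: j => [|[|[|[|?]]]].
by case: o; case: j => [|[|[|[|?]]]].
Qed.

Lemma partner_slot_neq c o j : j < 4 -> partner_slot c o j != j.
Proof.
rewrite /partner_slot; case: is_virt; first by case: j => [|[|[|[|?]]]].
by case: o; case: j => [|[|[|[|?]]]].
Qed.

Lemma partnerE d : (partner s d).2 = partner_slot (crs_at D d.1) (s d.1) d.2 :> nat.
Proof. by rewrite /partner /= inordK // partner_lt. Qed.

Lemma partnerK : involutive (partner s).
Proof.
move=> d; rewrite [partner s _]/partner partnerE /= partner_slotK // inord_val.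
by case: d.
Qed.

Lemma partner_neq d : partner s d != d.
Proof.
apply/eqP => E; have := partner_slot_neq (crs_at D d.1) (s d.1) (ltn_ord d.2).
by rewrite -partnerE E eqxx.
Qed.

Definition wmap (t : nat -> bool) : bool :=
  [forall k : 'I_(size (crs D)), all (jsat t) (junctions (crs_at D k) (s k))].

Lemma wmapP t : reflect (weight_map s t) (wmap t).
Proof. exact: forallP. Qed.

(** Ends joined by [partner_slot] are both incoming or both outgoing exactly at a bivalent vertex.
    Weights differ there and agree elsewhere, so in each case weight plus direction alternates. *)
Lemma jsat_slots c o t :
  all (jsat t) (junctions c o) =
  [forall j : 'I_4, t (slot c (partner_slot c o j)) (+) (1 < partner_slot c o j) ==
                 ~~ (t (slot c j) (+) (1 < j))].
Proof.
rewrite -[RHS]negbK negb_forall.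
have -> : [exists x : 'I_4, t (slot c (partner_slot c o x)) (+) (1 < partner_slot c o x)
     != ~~ (t (slot c x) (+) (1 < x))] =
   has (fun j => t (slot c (partner_slot c o j)) (+) (1 < partner_slot c o j)
     != ~~ (t (slot c j) (+) (1 < j))) (iota 0 4).
  apply/existsP/hasP => [[j jP]|[j]]; first by exists (j : nat); rewrite // mem_iota /=.
  by rewrite mem_iota => jlt jP; exists (Ordinal jlt).
rewrite /= /junctions /partner_slot; case: is_virt; last case: o; rewrite /= /jsat /=;
by case: (t (i1 c)); case: (t (i2 c)); case: (t (o1 c)); case: (t (o2 c)).
Qed.

Lemma wmap_alternating t : wmap t = alternating (@alpha D) (partner s) (flow t).
Proof.
apply/forallP/forallP => [tw d|talt k].
  rewrite /flow; case: (alphaP d) => -> ->; rewrite addbN eqxx /=.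
  have := tw d.1; rewrite jsat_slots => /forallP/(_ d.2).
  by rewrite /isout partnerE /lab partnerE.
rewrite jsat_slots; apply/forallP => j.
have /andP[_] := talt (k, j); by rewrite /flow /isout /lab partnerE.
Qed.

Lemma lab_ins d : lab d \in ins D.
Proof. by rewrite -[ins D]/(ends false) (mem_ends _ (isout d)) lab_mem. Qed.

Lemma card_wmap :
  \sum_(v <- bools (size (ins D))) wmap (lext (ins D) v) =
  2 ^ n_comp (curve_rel s) (predT : {pred dart D}).
Proof.
rewrite -(card_alternating alphaK partnerK alpha_neq partner_neq) //.
pose phi v : {ffun dart D -> bool} := [ffun d => flow (lext (ins D) v) d].
have phi_alt v : alternating (@alpha D) (partner s) (phi v) = wmap (lext (ins D) v).
  by rewrite wmap_alternating; apply: eq_forallb => d; rewrite !ffunE.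
pose S := [seq phi v | v <- bools (size (ins D)) & wmap (lext (ins D) v)].
have -> : \sum_(v <- bools (size (ins D))) wmap (lext (ins D) v) = size S.
  rewrite size_map size_filter -sum1_count [RHS]big_mkcond.
  by apply: eq_bigr => v _; case: wmap.
have uS : uniq S.
  rewrite map_inj_in_uniq ?filter_uniq ?uniq_bools // => v v'; rewrite !mem_filter !mem_bools.
  move=> /andP[_ /eqP sv] /andP[_ /eqP sv'] /ffunP vv'.
  apply: (@eq_from_nth _ false); rewrite sv ?sv' // => i ilt.
  have [d [ld _]] := @ends_lab false _ (mem_nth 0 ilt).
  have := vv' d; rewrite !ffunE /flow /lext ld index_uniq ?(uniq_ends false) //.
  exact: addIb.
rewrite -(card_uniqP uS); apply: eq_card => H; rewrite inE.
apply/mapP/idP => [[v]|Halt]; first by rewrite mem_filter => /andP[vw _] ->; rewrite phi_alt.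
(* A label takes the value read at its incoming dart; alternation under [alpha] makes the outgoing
   dart agree. *)
pose tH x := if [pick d | (lab d == x) && ~~ isout d] is Some d then H d else false.
have tHE d : tH (lab d) (+) isout d = H d.
  have tHin d' : ~~ isout d' -> tH (lab d') = H d'.
    rewrite /tH => od'; case: pickP => [d1 /andP[/eqP l1 o1]|/(_ d')]; last by rewrite eqxx od'.
    by rewrite (@lab_inj d1 d') // (negbTE od') (negbTE o1).
  have [od|od] := boolP (isout d); last by rewrite tHin // addbF.
  have [la oa] := alphaP d; rewrite -la tHin ?oa ?od // addbT.
  by have /forallP/(_ d)/andP[/eqP -> _] := Halt; rewrite negbK.
have HE : H = phi [seq tH x | x <- ins D].
  apply/ffunP => d; rewrite ffunE -tHE /flow /lext (nth_map 0) ?index_mem ?lab_ins //.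
  by rewrite nth_index ?lab_ins.
exists [seq tH x | x <- ins D] => //; rewrite mem_filter mem_bools size_map eqxx andbT.
by rewrite -phi_alt -HE.
Qed.
End Darts.

(** * Planarity *)

Section Exactness.
Local Open Scope ring_scope.

Definition fmx (F : fieldType) (T U : finType) (f : T -> U -> F) : 'M[F]_(#|T|, #|U|) :=
  \matrix_(i, j) f (enum_val i) (enum_val j).
Definition frow (F : fieldType) (T : finType) (x : T -> F) : 'rV[F]_#|T| :=
  \row_i x (enum_val i).

Lemma frow_mul (F : fieldType) (T U : finType) (x : T -> F) (f : T -> U -> F) :
  frow x *m fmx f = frow (fun u => \sum_t x t * f t u).
Proof.
apply/rowP => j; rewrite !mxE [RHS](reindex (@enum_val T T)) /=.
  by apply: eq_bigr => i _; rewrite !mxE.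
exact/onW_bij/enum_val_bij.
Qed.

Lemma fmx_mul (F : fieldType) (T U V : finType) (f : T -> U -> F) (g : U -> V -> F) :
  fmx f *m fmx g = fmx (fun t v => \sum_u f t u * g u v).
Proof.
apply/matrixP => i j; rewrite !mxE [RHS](reindex (@enum_val U U)) /=.
  by apply: eq_bigr => u _; rewrite !mxE.
exact/onW_bij/enum_val_bij.
Qed.

Lemma frowK (F : fieldType) (T : finType) (v : 'rV[F]_#|T|) :
  frow (fun t => v 0 (enum_rank t)) = v.
Proof. by apply/rowP => i; rewrite mxE enum_valK. Qed.

Lemma frowE (F : fieldType) (T : finType) (x : T -> F) t : frow x 0 (enum_rank t) = x t.
Proof. by rewrite mxE enum_rankK. Qed.

(** Evaluation along [g] is injective on the left kernel of [f], whose dimension is therefore at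
    most [#|C|]. *)
Lemma card_le_rank (F : fieldType) (T U C : finType) (f : T -> U -> F) (g : C -> T) :
    (forall x : T -> F, (forall u, \sum_t x t * f t u = 0) -> (forall c, x (g c) = 0) ->
       forall t, x t = 0) ->
  (#|T| <= \rank (fmx f) + #|C|)%N.
Proof.
move=> fg; pose S := fmx (fun t c => (t == g c)%:R : F).
have kS : (kermx (fmx f) :&: kermx S)%MS = 0.
  apply/eqP; rewrite -submx0; apply/row_subP => i.
  set v := row i _; have : (v <= kermx (fmx f) :&: kermx S)%MS by exact: row_sub.
  rewrite sub_capmx => /andP[/sub_kermxP vf /sub_kermxP vS].
  rewrite submx0; apply/eqP; rewrite -(frowK v).
  have v0 : forall t, v 0 (enum_rank t) = 0.
    apply: fg => [u|c].
      have := congr1 (fun w : 'rV_ _ => w 0 (enum_rank u)) vf.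
      by rewrite -{1}(frowK v) frow_mul frowE mxE.
    have := congr1 (fun w : 'rV_ _ => w 0 (enum_rank c)) vS.
    rewrite -{1}(frowK v) frow_mul frowE [in RHS]mxE (bigD1 (g c)) //= eqxx mulr1.
    by rewrite big1 ?addr0 // => t /negbTE ->; rewrite mulr0.
  by apply/rowP => j; rewrite [LHS]mxE v0 mxE.
have := mxrank_mul_ker (kermx (fmx f)) S; rewrite kS mxrank0 addn0 mxrank_ker.
have := rank_leq_col (kermx (fmx f) *m S); lia.
Qed.

(* Homology of a cell decomposition of spheres: with [C] indexing the components,
   the last inequality says that the Euler characteristic is [2 * #|C|], and then
   every cycle on the edges [E] bounds. *)
Lemma cycle_boundary (F : fieldType) (T E V C : finType) (d2 : T -> E -> F) (d1 : E -> V -> F)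
    (gT : C -> T) (gV : C -> V) :
    (forall t v, \sum_e d2 t e * d1 e v = 0) ->
    (forall x : T -> F, (forall e, \sum_t x t * d2 t e = 0) -> (forall c, x (gT c) = 0) ->
       forall t, x t = 0) ->
    (forall y : V -> F, (forall e, \sum_v y v * d1 e v = 0) -> (forall c, y (gV c) = 0) ->
       forall v, y v = 0) ->
    (#|E| + 2 * #|C| <= #|T| + #|V|)%N ->
  forall z : E -> F, (forall v, \sum_e z e * d1 e v = 0) ->
  exists x : T -> F, forall e, z e = \sum_t x t * d2 t e.
Proof.
move=> d12 ker2 ker1 euler z dz.
have d0 : fmx d2 *m fmx d1 = 0.
  by rewrite fmx_mul; apply/matrixP => i j; rewrite !mxE.
have r2 := card_le_rank ker2.
have r1 : (#|V| <= \rank (fmx d1) + #|C|)%N.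
  by rewrite -mxrank_tr (_ : (fmx d1)^T = fmx (fun v e => d1 e v));
    [exact: card_le_rank ker1 | apply/matrixP => i j; rewrite !mxE].
have sub : (fmx d2 <= kermx (fmx d1))%MS by apply/sub_kermxP.
have rk : \rank (kermx (fmx d1)) = (#|E| - \rank (fmx d1))%N by rewrite mxrank_ker.
(* The image of [d2] lies in the kernel of [d1]; the two rank bounds and the Euler inequality force
   equal dimensions. *)
have /eqmxP eqk : (fmx d2 == kermx (fmx d1))%MS.
  rewrite -(geq_leqif (mxrank_leqif_eq sub)) rk; lia.
have : (frow z <= fmx d2)%MS.
  rewrite eqk; apply/sub_kermxP; rewrite frow_mul; apply/rowP => j; rewrite !mxE.
  exact: dz.
case/submxP => w zw; exists (fun t => w 0 (enum_rank t)) => e.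
by rewrite -(frowE z) zw -{1}(frowK w) frow_mul frowE.
Qed.
End Exactness.

(** * Faces of a diagram and parity at virtual crossings *)

Section Planar.
Context (D : diagram) (vD : valid D).
Implicit Types (d : dart D).
Local Open Scope ring_scope.

Let wfD : wf D. Proof. by case/andP: vD. Qed.
Local Notation n := (size (crs D)).
Local Notation fp := (@face_perm D).

Lemma rot_inj : injective (@Defs.rot D).
Proof.
move=> [k j] [k' j']; rewrite /Defs.rot /= => -[-> jj]; congr (_, _).
have := congr1 (@nat_of_ord 4) jj; rewrite !inordK ?ltn_mod // => E; apply: val_inj => /=.
move: E; have := ltn_ord j; have := ltn_ord j'; lia.
Qed.

Lemma fp_inj : injective fp.
Proof. by move=> d d' /rot_inj /(inv_inj (alphaK wfD)). Qed.

Local Notation faceT := {d : dart D | froots fp d}.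
Local Notation compT := {k : 'I_n | roots (@share_edge D) k}.
Local Notation edgeT := ('I_n * bool)%type.

Definition face d : faceT := exist _ (froot fp d) (roots_root (fconnect_sym fp_inj) d).
Lemma face_val (r : faceT) : face (val r) = r.
Proof. by apply: val_inj => /=; apply/eqP; exact: valP r. Qed.
Lemma face_fp d : face (fp d) = face d.
Proof.
apply: val_inj => /=; apply/esym/(fingraph.rootP (fconnect_sym fp_inj)); exact: fconnect1.
Qed.

(** Every edge of a well-formed diagram has exactly one incoming dart, so a crossing and a bit
    encode an edge. *)
Definition indart (e : edgeT) : dart D := (e.1, inord e.2).

Lemma isout_indart e : ~~ isout (indart e).
Proof. by rewrite /isout /indart /= inordK; case: (e.2). Qed.

Lemma indartK d : ~~ isout d -> indart (d.1, odd d.2) = d.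
Proof.
case: d => k j; rewrite /isout /indart /= => jlt; congr (_, _); apply: val_inj => /=.
by rewrite inordK; move: jlt; case: (j : nat) => [|[|?]].
Qed.

Lemma sum_darts (V : zmodType) (g : dart D -> V) :
  \sum_d g d = \sum_(e : edgeT) (g (indart e) + g (alpha (indart e))).
Proof.
rewrite (bigID (@isout D)) /= addrC [X in _ + X](reindex_inj (inv_inj (alphaK wfD))) /=.
rewrite [X in _ + X](eq_bigl (fun d => ~~ isout d)) => [|d]; last by rewrite (alphaP wfD d).2.
rewrite -big_split /= (reindex indart) /=.
  by apply: eq_bigl => e; rewrite isout_indart.
exists (fun d => (d.1, odd d.2)) => [[k b] _|d /indartK //].
by rewrite /indart /= inordK; case: b.
Qed.

Lemma lab_indart_alpha d : exists e, d = indart e \/ d = alpha (indart e).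
Proof.
have [od|od] := boolP (isout d); last by exists (d.1, odd d.2); left; rewrite indartK.
exists ((alpha d).1, odd (alpha d).2); right; rewrite indartK ?(alphaP wfD d).2 ?od //.
by rewrite (alphaK wfD).
Qed.

Lemma share_edge_sym : connect_sym (@share_edge D).
Proof.
apply: sym_connect_sym => k k'.
by apply/existsP/existsP => -[j /existsP[j' E]]; exists j'; apply/existsP; exists j; rewrite eq_sym.
Qed.

Definition comp k : compT :=
  exist _ (fingraph.root (@share_edge D) k) (roots_root share_edge_sym k).

(** Two darts with the same label are equal or exchanged by [alpha], so invariance across edges
    propagates along paths of crossings. *)
Lemma share_edge_root (V : eqType) (y : 'I_n -> V) :
  (forall d, y (alpha d).1 = y d.1) -> forall k, y (fingraph.root (@share_edge D) k) = y k.
Proof.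
move=> ya k; have /connectP[q] := connect_root (@share_edge D) k.
elim: q k => [|k' q IH] k /= => [_ -> //|/andP[kk' pq]].
rewrite (fingraph.rootP share_edge_sym (connect1 kk')) => lq.
rewrite (IH _ pq lq); case/existsP: kk' => j /existsP[j' /eqP E].
have [oo|oo] := eqVneq (isout ((k, j) : dart D)) (isout ((k', j') : dart D)).
  by have [->] := lab_inj wfD oo E.
have al : alpha ((k, j) : dart D) = (k', j').
  apply: (lab_inj wfD); rewrite ?(alphaP wfD _).1 // (alphaP wfD _).2.
  by move: oo; do 2!case: isout.
by have := ya (k, j); rewrite al.
Qed.

(** The boundary maps over [bool], taken as the field with two elements. Adding the two sides gives
    zero for an edge with one face on both sides, and likewise for an edge with both ends at one
    crossing. *)
Definition bnd2 (r : faceT) (e : edgeT) : bool :=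
  (r == face (indart e)) (+) (r == face (alpha (indart e))).
Definition bnd1 (e : edgeT) (k : 'I_n) : bool :=
  ((indart e).1 == k) (+) ((alpha (indart e)).1 == k).

Lemma sum_bool_delta (T : finType) (x : T -> bool) (a b : T) :
  \sum_t x t * ((t == a) (+) (t == b)) = x a (+) x b.
Proof.
rewrite (eq_bigr (fun t => x t * (t == a) + x t * (t == b))); last first.
  by move=> t _; rewrite -mulrDr.
have delta c : \sum_t x t * (t == c) = x c.
  rewrite (bigD1 c) //= eqxx mulr1 big1 ?addr0 // => t /negbTE ->; exact: mulr0.
by rewrite big_split /= !delta.
Qed.

(** A dart stands for a corner next to it at its crossing: the faces of [d] and [rot d] lie on the
    two sides of its edge. *)
Lemma face_alpha d : face (alpha d) = face (Defs.rot d).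
Proof. by rewrite -(face_fp (alpha d)) /face_perm (alphaK wfD). Qed.

Lemma sum4 (V : zmodType) (g : 'I_4 -> V) :
  \sum_j g j = g (inord 0) + g (inord 1) + g (inord 2) + g (inord 3).
Proof.
by rewrite !big_ord_recr big_ord0 /= add0r; do !congr (_ + _); congr g; apply: val_inj;
  rewrite /= inordK.
Qed.

Lemma sum_dart_pair (V : zmodType) (g : dart D -> V) : \sum_d g d = \sum_k \sum_j g (k, j).
Proof. by rewrite pair_bigA; apply: eq_bigr => -[]. Qed.

Lemma rot_inord k j : (j < 4)%N -> Defs.rot ((k, inord j) : dart D) = (k, inord (j.+1 %% 4)).
Proof. by move=> jlt; rewrite /Defs.rot /= inordK. Qed.

Lemma lab_inord k j : (j < 4)%N -> lab ((k, inord j) : dart D) = slot (crs_at D k) j.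
Proof. by move=> jlt; rewrite /lab /= inordK. Qed.

Lemma planar_cycle_boundary (z : nat -> bool) :
    (forall k : 'I_n, let c := crs_at D k in z (i1 c) (+) z (i2 c) (+) z (o1 c) (+) z (o2 c) = false) ->
  exists phi : dart D -> bool, forall d,
    z (lab d) = phi d (+) phi (Defs.rot d) /\ phi (alpha d) = phi (Defs.rot d).
Proof.
move=> zc; pose ze (e : edgeT) := z (lab (indart e)).
have sum_slots (g : dart D -> bool) k :
   \sum_e (g (indart e) * ((indart e).1 == k) + g (alpha (indart e)) * ((alpha (indart e)).1 == k)) =
   g (k, inord 0) + g (k, inord 1) + g (k, inord 2) + g (k, inord 3).
  rewrite -(sum_darts (fun d => g d * (d.1 == k))) -[RHS](sum4 (fun j => g (k, j))).
  rewrite sum_dart_pair (bigD1 k) //= addrC big1 ?add0r.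
    by apply: eq_bigr => j _; rewrite eqxx mulr1.
  by move=> k' /negbTE ->; rewrite big1 // => j _; rewrite mulr0.
have [|||||x xz] := @cycle_boundary _ faceT edgeT 'I_n compT bnd2 bnd1
   (fun c => face (val c, inord 0)) (fun c => val c) _ _ _ _ ze.
(* The boundary of a boundary is zero: each of the four corners at a crossing is met by two
   consecutive darts and cancels. *)
- move=> r k; pose g d := (r == face d) (+) (r == face (alpha d)).
  transitivity (g (k, inord 0) + g (k, inord 1) + g (k, inord 2) + g (k, inord 3)).
    rewrite -sum_slots; apply: eq_bigr => e _; rewrite /g (alphaK wfD) /bnd2 /bnd1.
    by rewrite [X in _ = _ + X * _]addbC -mulrDr.
  rewrite /g !face_alpha !rot_inord //=.
  by do 4!case: (r == _).
(* A set of faces without boundary has the same value across each edge, hence at all corners of a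
   crossing, hence on a whole component. *)
- move=> x xe x0 r; rewrite -(face_val r).
  have xa d : x (face (alpha d)) = x (face d).
    have xi e : x (face (indart e)) = x (face (alpha (indart e))).
      by have := xe e; rewrite sum_bool_delta; do 2!case: (x _).
    by case: (lab_indart_alpha d) => e [->|->]; rewrite ?(alphaK wfD) xi.
  have xr k j : (j < 4)%N -> x (face (k, inord j)) = x (face (k, inord 0)).
    elim: j => // j IH jlt; rewrite -IH ?(ltnW jlt) //.
    by rewrite -(xa (k, inord j)) face_alpha rot_inord ?(ltnW jlt) // modn_small.
  have xk d : x (face d) = x (face (d.1, inord 0)).
    by rewrite -(xr d.1 d.2) ?ltn_ord // inord_val; case: d.
  rewrite xk -(share_edge_root (y := fun k => x (face (k, inord 0)))).
    by rewrite -(x0 (comp (val r).1)).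
  by move=> d; rewrite -!xk xa.
- move=> y ye y0 k; rewrite -(share_edge_root (y := y)).
    by rewrite -(y0 (comp k)).
  have yi e : y (alpha (indart e)).1 = y (indart e).1.
    have := ye e; rewrite /bnd1 (eq_bigr (fun v => y v * ((v == (indart e).1) (+)
        (v == (alpha (indart e)).1)))); last by move=> v _; rewrite ![v == _]eq_sym.
    by rewrite sum_bool_delta; do 2!case: (y _).
  by move=> d; case: (lab_indart_alpha d) => e [->|->]; rewrite ?(alphaK wfD) yi.
(* With [2 * n] edges and [n] vertices, Euler's formula gives equality here. *)
- case/andP: vD => _ /eqP; rewrite /nfaces /ncomp_cr => euler.
  rewrite !card_sig card_prod card_bool card_ord.
  have -> : #|[pred d | froots fp d]| = fcard fp (predT : {pred dart D}).
    by apply: eq_card => d; rewrite !inE andbT.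
  have -> : #|[pred k | roots (@share_edge D) k]| = n_comp (@share_edge D) (predT : {pred 'I_n}).
    by apply: eq_card => d; rewrite !inE andbT.
  by rewrite euler; lia.
- move=> k; transitivity (\sum_e (z (lab (indart e)) * ((indart e).1 == k) +
      z (lab (alpha (indart e))) * ((alpha (indart e)).1 == k))).
    by apply: eq_bigr => e _; rewrite (alphaP wfD _).1 -mulrDr.
  by rewrite (sum_slots (fun d => z (lab d))) !lab_inord //; exact: zc.
exists (fun d => x (face d)) => d; rewrite -face_alpha; split=> //.
have xze e : z (lab (indart e)) = x (face (indart e)) (+) x (face (alpha (indart e))).
  by rewrite -sum_bool_delta; exact: xz.
case: (lab_indart_alpha d) => e [->|->]; first exact: xze.
by rewrite (alphaP wfD _).1 (alphaK wfD) addbC xze.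
Qed.

Lemma virt_parity (s : state D) (t t' : nat -> bool) : wmap s t -> wmap s t' ->
  \sum_(k < n | is_virt (crs_at D k)) (t (i1 (crs_at D k)) != t (i2 (crs_at D k))) =
  \sum_(k < n | is_virt (crs_at D k)) (t' (i1 (crs_at D k)) != t' (i2 (crs_at D k))).
Proof.
move=> /forallP tw /forallP tw'; pose z x := t x (+) t' x.
have zj (k : 'I_n) : all (fun j => z j.1.1 == z j.1.2) (junctions (crs_at D k) (s k)).
  apply/allP => j jin; move: (allP (tw k) j jin) (allP (tw' k) j jin); rewrite /jsat /z.
  by case: (t _); case: (t _); case: (t' _); case: (t' _); case: j.2.
have zc (k : 'I_n) : let c := crs_at D k in z (i1 c) (+) z (i2 c) (+) z (o1 c) (+) z (o2 c) = false.
  by move: (zj k); rewrite /junctions /=; case: is_virt; last case: (s k);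
    move=> /= /and3P[/eqP -> /eqP -> _]; do 2!case: (z _).
have [phi phiz] := planar_cycle_boundary zc.
(* The side [phi] is summed over the darts where [z] vanishes; both ends of such an edge see the
   same side, so the sum is even. *)
have : \sum_d (~~ z (lab d)) * phi d = 0 :> bool.
  rewrite sum_darts big1 // => e _; have [ze pe] := phiz (indart e).
  by rewrite (alphaP wfD _).1 pe -mulrDr -[phi _ + _]ze; case: (z _).
rewrite sum_dart_pair.
(* The four contributions at a crossing cancel, except at a virtual crossing where [z] is true on
   one strand only: the ends of the other strand lie on opposite sides. *)
have cross (k : 'I_n) : \sum_(j < 4) (~~ z (lab ((k, j) : dart D))) * phi (k, j) =
    is_virt (crs_at D k) && (z (i1 (crs_at D k)) != z (i2 (crs_at D k))).
  rewrite sum4 !lab_inord //.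
  have := (phiz (k, inord 0)).1; rewrite rot_inord // lab_inord // => E0.
  have := (phiz (k, inord 1)).1; rewrite rot_inord // lab_inord // => E1.
  have := (phiz (k, inord 2)).1; rewrite rot_inord // lab_inord // => E2.
  have := (phiz (k, inord 3)).1; rewrite rot_inord // lab_inord // => E3.
  move: (zj k); rewrite /junctions /=; move: E0 E1 E2 E3; rewrite /= => E0 E1 E2 E3.
  by case: is_virt; last case: (s k); rewrite /= E0 E1 ?E2 ?E3; do 4!case: (phi _).
rewrite (eq_bigr _ (fun k _ => cross k)) => zero.
apply/eqP; rewrite -subr_eq0 -sumrB; apply/eqP; rewrite -[RHS]zero [LHS]big_mkcond.
apply: eq_bigr => k _; case: is_virt => //=; rewrite /z.
by do 2!case: (t _); do 2!case: (t' _).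
Qed.
End Planar.

(** * The state sum *)

Local Open Scope ring_scope.

Definition bcons (b : bool) (g : nat -> bool) (i : nat) : bool := if i is j.+1 then g j else b.

Lemma ext_ord M (t : {ffun 'I_M -> bool}) (i : 'I_M) : ext t i = t i.
Proof. by rewrite /ext valK. Qed.

Lemma ext_default M (t : {ffun 'I_M -> bool}) i : (M <= i)%N -> ext t i = false.
Proof. by move=> Mi; rewrite /ext insubN // -leqNgt. Qed.

Lemma sum_ext_recl (V : nmodType) n (G : (nat -> bool) -> V) :
  \sum_(s : {ffun 'I_n.+1 -> bool}) G (ext s) =
  \sum_(b : bool) \sum_(s : {ffun 'I_n -> bool}) G (bcons b (ext s)).
Proof.
pose f (bs : bool * {ffun 'I_n -> bool}) : {ffun 'I_n.+1 -> bool} :=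
  [ffun i : 'I_n.+1 => bcons bs.1 (ext bs.2) i].
have extf bs : ext (f bs) = bcons bs.1 (ext bs.2).
  apply: functional_extensionality => i; case: (ltnP i n.+1) => ni.
    by rewrite -[i]/(nat_of_ord (Ordinal ni)) ext_ord ffunE.
  by rewrite ext_default //; case: i ni => // i ni; rewrite /= ext_default.
rewrite (reindex f) /= ?pair_bigA.
  by apply: eq_bigr => -[b s] _; rewrite extf.
exists (fun t => (t ord0, [ffun i => t (lift ord0 i)])) => [[b s] _|t _].
  congr (_, _); first by rewrite ffunE.
  by apply/ffunP => i; rewrite !ffunE /= ext_ord.
apply/ffunP => i; rewrite ffunE /=; case: (unliftP ord0 i) => [j ->|->] //=.
by rewrite ext_ord ffunE.
Qed.

Fixpoint spiece (cs : seq crossing) (g : nat -> bool) : piece :=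
  if cs is c :: cs' then pcat (res c (g 0%N)) (spiece cs' (fun i => g i.+1)) else ([::], [::]).

Definition cweight (K : fieldType) (A : K) (c : crossing) (b : bool) : K :=
  \sum_(mb <- opts c | mb.2 == b) mono_eval A mb.1.

(** Terms with the same resolutions are grouped; only at singular crossings do several monomials
    belong to one resolution. *)
Lemma term_sum_states (K : fieldType) (A : K) (A0 : A != 0) cs F :
  term_sum A cs F = \sum_(s : {ffun 'I_(size cs) -> bool})
    (\prod_(k < size cs) cweight A (nth dummy_cr cs k) (ext s k)) * F (spiece cs (ext s)).
Proof.
elim: cs F => [|c cs IH] F.
  rewrite term_sum_nil (big_pred1 [ffun=> false]) /= ?big_ord0 ?mul1r // => s.
  by apply/esym/eqP/ffunP => -[].
rewrite term_sum_cons // (sum_ext_recl _ (fun g => (\prod_(k < (size cs).+1)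
   cweight A (nth dummy_cr (c :: cs) k) (g k)) * F (spiece (c :: cs) g))).
rewrite (partition_big snd predT) //=; apply: eq_bigr => b _.
transitivity (cweight A c b * term_sum A cs (fun P => F (pcat (res c b) P))).
  by rewrite /cweight mulr_suml; apply: eq_bigr => mb /eqP ->.
rewrite IH mulr_sumr; apply: eq_bigr => s _.
by rewrite big_ord_recl /= mulrA.
Qed.

Lemma has_sign_spiece cs g t e :
  has_sign (spiece cs g) t e =
    [forall k : 'I_(size cs), all (jsat t) (junctions (nth dummy_cr cs k) (g k))] &&
    (\sum_(k < size cs | is_virt (nth dummy_cr cs k))
       (t (i1 (nth dummy_cr cs k)) != t (i2 (nth dummy_cr cs k))) == e).
Proof.
have -> : [forall k : 'I_(size cs), all (jsat t) (junctions (nth dummy_cr cs k) (g k))] =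
    \big[andb/true]_(k < size cs) all (jsat t) (junctions (nth dummy_cr cs k) (g k)).
  by rewrite big_andE; apply: eq_forallb.
rewrite /has_sign; congr (_ && _); last congr (_ == _).
  elim: cs g => [|c cs IH] g; first by rewrite big_ord0.
  by rewrite big_ord_recl /= all_cat IH.
elim: cs g => [|c cs IH] g; first by rewrite big_ord0.
rewrite big_mkcond big_ord_recl /= vpar_cat IH -big_mkcond.
by case: is_virt => //=; rewrite addbF.
Qed.

Definition kcount (c : crossing) (b : bool) (kd : ckind) (o : bool) : nat :=
  kind_eq (ck c) kd && (b == o).

Definition kexp (c : crossing) (b : bool) : int :=
  2 * ((kcount c b Neg true)%:Z - (kcount c b Pos true)%:Z)
  + 4 * ((kcount c b Neg false)%:Z - (kcount c b Pos false)%:Z).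

(** [opts] has no entry for [false] at a virtual crossing; the resulting zero factor implements the
    restriction to [is_state]. *)
Lemma cweightE (K : fieldType) (A : K) c b :
  cweight A c b = (is_virt c ==> b)%:R * ((-1) ^+ is_classical c * A ^ kexp c b *
    loop_value A ^+ kcount c b Sing true * (- A ^+ 4 - A ^- 4) ^+ kcount c b Sing false).
Proof.
rewrite /cweight /kexp /kcount /opts /is_virt /is_classical /mono_eval /loop_value; case: (ck c); case: b;
  rewrite !big_cons big_nil /=; rewrite ?expr0 ?expr1 ?mulr1 ?mul1r ?mul0r ?addr0 ?mulN1r //.
all: exact: addrC.
Qed.

Lemma prod_cweight (K : fieldType) (A : K) (A0 : A != 0) D (s : state D) :
  \prod_(k < size (crs D)) cweight A (crs_at D k) (s k) =
  (is_state s)%:R * ((-1) ^+ count is_classical (crs D) *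
    A ^ (2 * ((cnt s Neg true)%:Z - (cnt s Pos true)%:Z)
         + 4 * ((cnt s Neg false)%:Z - (cnt s Pos false)%:Z)) *
    loop_value A ^+ cnt s Sing true * (- A ^+ 4 - A ^- 4) ^+ cnt s Sing false).
Proof.
have cntE kd o : cnt s kd o = (\sum_(k < size (crs D)) kcount (crs_at D k) (s k) kd o)%N.
  by rewrite /cnt -sum1_card [LHS]big_mkcond; apply: eq_bigr => k _; rewrite inE /kcount; case: andb.
have countE : count is_classical (crs D) = (\sum_(k < size (crs D)) is_classical (crs_at D k))%N.
  rewrite -sum1_count big_mkcond (big_nth dummy_cr) big_mkord.
  by apply: eq_bigr => k _; rewrite /crs_at; case: is_classical.
rewrite (eq_bigr _ (fun (k : 'I_(size (crs D))) _ => cweightE A (crs_at D k) (s k))) !big_split /=.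
rewrite !prodrXr -countE -!cntE; congr (_ * (_ * _ * _ * _)).
  rewrite /is_state; case: (boolP [forall _, _]) => [/forallP st|].
    by rewrite big1 // => k _; rewrite st.
  by rewrite negb_forall => /existsP[k /negbTE kF]; rewrite (bigD1 k) //= kF mul0r.
rewrite -(big_morph (fun e : int => A ^ e) (fun x y => expfzDr x y A0) (expr0z A)).
congr (_ ^ _); rewrite /kexp big_split /= -!mulr_sumr !sumrB !cntE.
by rewrite !(big_morph Posz PoszD (erefl 0%Z)).
Qed.

Section StateSum.
Context (D : diagram) (vD : valid D) (M : nat) (labM : all (fun x => x < M)%N (ins D)).
Let wfD : wf D. Proof. by case/andP: vD. Qed.
Local Notation n := (size (crs D)).

Lemma edges_le : (2 * n <= M)%N.
Proof.
rewrite -(size_ins D) -[M](size_iota 0); apply: uniq_leq_size; first by case/and3P: wfD.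
by move=> x /(allP labM); rewrite mem_iota.
Qed.

Lemma wmap_eq_in (s : state D) t t' : {in ins D, t =1 t'} -> wmap s t = wmap s t'.
Proof.
move=> tt'; rewrite !wmap_alternating //; apply: eq_forallb => d.
by rewrite /flow !tt' ?lab_ins.
Qed.

(** The [2 * n] edge labels give a factor 2 per closed curve with double points; the other
    [M - 2 * n] labels are free. *)
Lemma sum_wmap (s : state D) :
  (\sum_(t : {ffun 'I_M -> bool}) wmap s (ext t) =
    2 ^ (M - 2 * n + n_comp (curve_rel s) (predT : {pred dart D})))%N.
Proof.
have uL : uniq (ins D) by case/and3P: wfD.
have := @sum_lext M _ (fun t => wmap s t : nat) uL labM.
rewrite card_wmap // size_ins => E; apply/eqP.
rewrite -(eqn_pmul2l (expn_gt0 2 (2 * n))) E; last by move=> t t' /wmap_eq_in ->.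
by rewrite -!expnD addnA subnKC // edges_le.
Qed.

Definition vparity (t : nat -> bool) : bool :=
  \sum_(k < n | is_virt (crs_at D k)) (t (i1 (crs_at D k)) != t (i2 (crs_at D k))).

Lemma iS_sign (s : state D) : iS s = (-1) ^+ vparity (some_weight_map s).
Proof.
rewrite /iS /vparity; set t := some_weight_map s.
apply: (big_ind2 (fun (x : int) (b : bool) => x = (-1) ^+ b)) => //.
  by move=> x b y b' -> ->; rewrite signr_addb.
by move=> k _; case: eqP.
Qed.

(** By [virt_parity] all weight maps of a state have the same sign, so one of the two counts is 0
    and the other is the full power of 2. *)
Lemma count_weight_state (K : fieldType) (A h : K) (s : state D) :
  count_weight A h (wcount M (spiece (crs D) (ext s))) =
  loop_value A ^+ (M - 2 * n + n_comp (curve_rel s) (predT : {pred dart D})) *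
    (if iS s == 1 then 1 else h).
Proof.
(* The number of weight maps is a power of 2, so one exists and the choice by [epsilon] is
   legitimate. *)
have wmap_ex : wmap s (some_weight_map s).
  apply/wmapP; apply: epsilon_spec.
  have : (0 < \sum_(t : {ffun 'I_M -> bool}) wmap s (ext t))%N by rewrite sum_wmap expn_gt0.
  rewrite lt0n sum_nat_eq0 negb_forall => /existsP[t]; rewrite eqb0 negbK => wt.
  by exists (ext t); apply/wmapP.
have cntE e : wcount M (spiece (crs D) (ext s)) e =
    ((vparity (some_weight_map s) == e) * \sum_(t : {ffun 'I_M -> bool}) wmap s (ext t))%N.
  rewrite /wcount big_distrr; apply: eq_bigr => t _; rewrite has_sign_spiece /=.
  have -> : [forall k : 'I_n, all (jsat (ext t)) (junctions (nth dummy_cr (crs D) k) (ext s k))] =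
      wmap s (ext t) by apply: eq_forallb => k; rewrite ext_ord.
  case wt : (wmap s (ext t)); last by rewrite muln0.
  by rewrite (virt_parity vD wt wmap_ex) muln1.
rewrite /count_weight !cntE sum_wmap iS_sign.
case: vparity; rewrite /= !(mul0n, mul1n, add0n, addn0) expn_eq0 /= trunc_expnK //.
Qed.

Lemma Rgen_weight_sum (K : fieldType) (A h : K) (A0 : A != 0) :
  loop_value A ^+ (M - 2 * n) * Rgen A h D =
  loop_value A ^+ loops D * term_sum A (crs D) (fun P => count_weight A h (wcount M P)).
Proof.
rewrite term_sum_states // /Rgen !mulr_sumr [LHS]big_mkcond; apply: eq_bigr => s _.
rewrite count_weight_state; under eq_bigr do rewrite ext_ord.
rewrite prod_cweight //; case: is_state; last by rewrite !mul0r mulr0.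
rewrite mul1r /ncurves !exprD.
set x := loop_value A; rewrite -[- A ^+ 2 - A ^- 2]/x; ring.
Qed.
End StateSum.

(** * Moves *)

Local Close Scope ring_scope.

Definition ends_in (cs : seq crossing) := flatten [seq [:: i1 c; i2 c] | c <- cs].
Definition ends_out (cs : seq crossing) := flatten [seq [:: o1 c; o2 c] | c <- cs].

Lemma relab_ux f k s0 s1 s2 s3 a b :
  relab f (ux k s0 s1 s2 s3 a b) = ux k (f s0) (f s1) (f s2) (f s3) a b.
Proof. by case: a; case: b. Qed.

Lemma perm_flatten_map (T : Type) (g : T -> seq nat) cs ds :
  Permutation.Permutation cs ds -> perm_eq (flatten (map g cs)) (flatten (map g ds)).
Proof.
elim=> //= [c {}cs {}ds _ IH|c d es|{}cs es {}ds _ IH1 _ IH2].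
- by rewrite perm_cat2l.
- by rewrite perm_catCA.
- exact: perm_trans IH1 IH2.
Qed.

Lemma terms_labs cs t x : t \in terms cs -> x \in plabs t.2 ->
  (x \in ends_in cs) || (x \in ends_out cs).
Proof.
elim: cs t => [|c cs IH] t; first by rewrite inE => /eqP ->.
case/allpairsP => -[mb u] /= [_ /IH{}IH ->] /=.
have -> : (x \in plabs (pcat (res c mb.2) u.2)) =
    (x \in plabs (res c mb.2)) || (x \in plabs u.2).
  by rewrite /plabs /pcat /= !map_cat !flatten_cat !mem_cat orbACA.
case/orP=> [|/IH]; last by rewrite /ends_in /ends_out /= !inE => /orP[] ->; rewrite !orbT.
rewrite /plabs /res /junctions /ends_in /ends_out /= !inE.
have slots : x \in [:: i1 c; i2 c; o1 c; o2 c] ->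
    [|| x == i1 c, x == i2 c | x \in ends_in cs] || [|| x == o1 c, x == o2 c | x \in ends_out cs].
  by rewrite !inE => /or4P[] ->; rewrite ?orbT.
move=> xc; apply: slots; move: xc.
case: is_virt; last case: mb.2; rewrite /= !inE -?orbA;
  by do ?[case/orP=> [/eqP ->|]]; rewrite ?eqxx ?orbT // => /eqP ->; rewrite eqxx ?orbT.
Qed.

Definition inner_ok (nb nin : nat) (cs : seq crossing) : bool :=
  all (fun i => (i \in ends_in cs) && (i \in ends_out cs)) (iota nb nin) &&
  all (fun i => (i \in ends_in cs) || (i \in ends_out cs)) (iota 0 (nb + nin)).

Lemma uniq_map_inj (f : nat -> nat) s x y :
  uniq (map f s) -> x \in s -> y \in s -> f x = f y -> x = y.
Proof.
elim: s => //= z s IH /andP[zs us]; rewrite !inE.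
case/predU1P=> [->|xs] /predU1P[->|ys] // E; last exact: IH.
  by rewrite E map_f in zs.
by rewrite -E map_f in zs.
Qed.

(** A label occurs once among the incoming and once among the outgoing ends. By [inner_ok] the
    tangle contains both occurrences of each inner label, so none is left elsewhere. *)
Lemma fresh_inner_wf D M nb nin f rest cs t :
    wf D -> all (fun x => x < M) (ins D) ->
    Permutation.Permutation (crs D) (rest ++ map (relab f) cs) ->
    inner_ok nb nin cs -> t \in terms rest ->
  fresh_inner M nb nin f t.2.
Proof.
case/and3P=> uin uout /perm_mem io /allP labM perm /andP[/allP inner /allP used] tr.
have map_in : ends_in (map (relab f) cs) = map f (ends_in cs).
  by rewrite /ends_in map_flatten -!map_comp.
have map_out : ends_out (map (relab f) cs) = map f (ends_out cs).
  by rewrite /ends_out map_flatten -!map_comp.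
have pin : perm_eq (ins D) (ends_in rest ++ map f (ends_in cs)).
  by rewrite -map_in /ends_in -flatten_cat -map_cat; apply: perm_flatten_map perm.
have pout : perm_eq (outs D) (ends_out rest ++ map f (ends_out cs)).
  by rewrite -map_out /ends_out -flatten_cat -map_cat; apply: perm_flatten_map perm.
rewrite (perm_uniq pin) cat_uniq in uin; case/and3P: uin => _ /hasPn din uin.
rewrite (perm_uniq pout) cat_uniq in uout; case/and3P: uout => _ /hasPn dout uout.
have innerP i : nb <= i < nb + nin -> (i \in ends_in cs) /\ (i \in ends_out cs).
  by move=> ii; apply/andP; apply: inner; rewrite mem_iota.
have usedP i : i < nb + nin -> (i \in ends_in cs) || (i \in ends_out cs).
  by move=> ii; apply: used; rewrite mem_iota.
split.
- move=> i /usedP/orP[] /(map_f f) fi; apply: labM.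
    by rewrite (perm_mem pin) mem_cat fi orbT.
  by rewrite io (perm_mem pout) mem_cat fi orbT.
- move=> i j /innerP[ii io'] /usedP/orP[] jj.
    exact: uniq_map_inj uin ii jj.
  exact: uniq_map_inj uout io' jj.
- move=> i /innerP[/(map_f f) ii /(map_f f) io']; apply/negP => /(terms_labs tr) /orP[].
    by apply/negP/din.
  by apply/negP/dout.
Qed.

Local Open Scope ring_scope.

Definition weight_sum (K : fieldType) (A h : K) (M : nat) (cs : seq crossing) : K :=
  term_sum A cs (fun P => count_weight A h (wcount M P)).

Lemma wcount_eq M P Q : (forall t e, has_sign P t e = has_sign Q t e) -> wcount M P =1 wcount M Q.
Proof. by move=> PQ e; apply: eq_bigr => t _; rewrite PQ. Qed.

Lemma weight_sum_perm (K : fieldType) (A h : K) (A0 : A != 0) M cs ds :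
  Permutation.Permutation cs ds -> weight_sum A h M cs = weight_sum A h M ds.
Proof. by move=> cd; apply: term_sum_perm => // P Q PQ; apply/count_weight_ext/wcount_eq. Qed.

Lemma term_sum_eq_in (K : fieldType) (A : K) cs F G :
  {in terms cs, forall t, F t.2 = G t.2} -> term_sum A cs F = term_sum A cs G.
Proof. by move=> FG; rewrite /term_sum big_seq [RHS]big_seq; apply: eq_bigr => t /FG ->. Qed.

Lemma term_sum_scale (K : fieldType) (A : K) cs F (x : K) :
  term_sum A cs (fun P => x * F P) = x * term_sum A cs F.
Proof. by rewrite /term_sum mulr_sumr; apply: eq_bigr => t _; rewrite mulrCA. Qed.

Section Moves.
Context (K : fieldType) (A h : K) (A0 : A != 0) (dA0 : loop_value A != 0).
Context (D D' : diagram) (vD : valid D) (vD' : valid D').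
Let wfD : wf D. Proof. by case/andP: vD. Qed.
Let wfD' : wf D'. Proof. by case/andP: vD'. Qed.

Lemma label_bound : exists M, all (fun x => x < M)%N (ins D) && all (fun x => x < M)%N (ins D').
Proof.
exists (\sum_(x <- ins D ++ ins D') x).+1; rewrite -all_cat; apply/allP => x xin.
by rewrite ltnS (big_rem x) //= leq_addr.
Qed.

Lemma Rgen_eq M m (labM : all (fun x => x < M)%N (ins D)) (labM' : all (fun x => x < M)%N (ins D')) :
    (2 * size (crs D') + m = 2 * size (crs D))%N ->
    loop_value A ^+ (m + loops D) * weight_sum A h M (crs D) = loop_value A ^+ loops D' * weight_sum A h M (crs D') ->
  Rgen A h D = Rgen A h D'.
Proof.
move=> sDD' sumE; have := edges_le vD labM; have := edges_le vD' labM' => le' le.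
have := Rgen_weight_sum vD labM h A0; have := Rgen_weight_sum vD' labM' h A0.
rewrite -!/(weight_sum A h M _) -sumE exprD -mulrA => E' E; rewrite -E mulrA -exprD in E'.
apply/esym/(mulfI _ (etrans E' _)); first by rewrite expf_neq0.
by congr (_ ^+ _ * _); lia.
Qed.

Lemma Rgen_local nb nin f f' T T' rest :
    local_check nb nin nin (terms T) (terms T') ->
    inner_ok nb nin T -> inner_ok nb nin T' -> size T = size T' ->
    {in iota 0 nb, f =1 f'} ->
    Permutation.Permutation (crs D) (rest ++ map (relab f) T) ->
    Permutation.Permutation (crs D') (rest ++ map (relab f') T') ->
    loops D = loops D' ->
  Rgen A h D = Rgen A h D'.
Proof.
move=> ok iT iT' sT ff' pD pD' lE; have [M /andP[labM labM']] := label_bound.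
have sz (cs ds : seq crossing) : Permutation.Permutation cs ds -> size cs = size ds.
  exact: Permutation.Permutation_length.
apply: (@Rgen_eq M 0 labM labM').
  by rewrite (sz _ _ pD) (sz _ _ pD') !size_cat !size_map sT addn0.
rewrite add0n lE (weight_sum_perm h A0 M pD) (weight_sum_perm h A0 M pD'); congr (_ * _).
rewrite /weight_sum !term_sum_cat //; apply: term_sum_eq_in => t tr.
have fr := fresh_inner_wf wfD labM pD iT tr.
have fr' := fresh_inner_wf wfD' labM' pD' iT' tr.
rewrite !term_sum_relab //; apply: (mulfI (expf_neq0 nin dA0)).
exact: (local_check_sound h A0 ok ff' fr fr').
Qed.

(** Two labels disappear per removed crossing: those of the inner edges and one for each reconnected
    strand, whether it merges two edges or closes into a free loop. *)
Lemma Rgen_reduce nb nin f T ps rest j :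
    local_check nb nin 0 (terms T) (sterm ps) ->
    inner_ok nb nin T -> all (fun p => (p.1 < nb) && (p.2 < nb))%N ps ->
    (nin + size ps = 2 * size T)%N ->
    Permutation.Permutation (crs D) (rest ++ map (relab f) T) ->
    join [seq (f p.1, f p.2) | p <- ps] id 0 = j ->
    Permutation.Permutation (crs D') (map (relab j.1) rest ++ [::]) ->
    (loops D' = loops D + j.2)%N ->
  Rgen A h D = Rgen A h D'.
Proof.
move=> ok iT /allP psb szE pD jE; rewrite cats0 => pD' lE.
have [M /andP[labM labM']] := label_bound.
have sz (cs ds : seq crossing) : Permutation.Permutation cs ds -> size cs = size ds.
  exact: Permutation.Permutation_length.
apply: (@Rgen_eq M (nin + size ps) labM labM').
  by rewrite (sz _ _ pD) (sz _ _ pD') size_cat !size_map szE mulnDr.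
rewrite lE (addnC _ (loops D)) !exprD -!mulrA; congr (_ * _).
rewrite (weight_sum_perm h A0 M pD) (weight_sum_perm h A0 M pD') /weight_sum term_sum_cat // term_sum_relab //.
rewrite -!term_sum_scale; apply: term_sum_eq_in => t tr.
have fr := fresh_inner_wf wfD labM pD iT tr.
have fr0 : fresh_inner M nb 0 f t.2.
  case: fr => [fM finj fP]; split=> [i|i i'|i]; rewrite ?addn0.
  - by move=> ib; apply: fM; rewrite (leq_trans ib) ?leq_addr.
  - by case/andP=> nbi ib; rewrite ltnNge nbi in ib.
  - by case/andP=> nbi ib; rewrite ltnNge nbi in ib.
have := local_check_sound h A0 ok (fun _ _ => erefl) fr fr0.
rewrite expr0 mul1r /sterm big_seq1 /= {2}/mono_eval expr0 expr0z !mul1r => E.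
rewrite term_sum_relab // mulrCA E.
have -> : prelab f (strands ps) = strands [seq (f p.1, f p.2) | p <- ps].
  by rewrite /prelab /strands /= -!map_comp.
have psM : all (fun p => (p.1 < M) && (p.2 < M))%N [seq (f p.1, f p.2) | p <- ps].
  case: fr => fM _ _; apply/allP => _ /mapP[p /psb /andP[p1 p2] ->] /=.
  by rewrite !fM ?(leq_trans p1) ?(leq_trans p2) ?leq_addr.
have wE e := wcount_strands t.2 e psM; rewrite size_map jE in wE.
pose N' e := (2 ^ j.2 * wcount M (prelab j.1 t.2) e)%N.
rewrite -(count_weight_scale A h (N := N') (fun e => esym (wE e))).
exact: count_weight_scale.
Qed.
End Moves.

Local Close Scope ring_scope.

(** * Local pictures of the moves and their finite checks *)

Definition curl_a k d := [:: ux k 0 2 2 1 d d].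
Definition curl_b k d := [:: ux k 0 1 2 2 d (~~ d)].
Definition bigon k dA dB := [:: ux k 0 1 4 5 dA dB; ux k 4 3 2 5 dA (~~ dB)].
(** Numbered in the order [[l1; l3; r1; r3; l2; r2]] of the labels of [mv_RS2]. *)
Definition twist1 b dL dR := [:: ux (UCl b) 0 2 4 5 dL dR; ux USing 5 4 3 1 dR dL].
Definition twist2 b dL dR := [:: ux USing 0 2 4 5 dL dR; ux (UCl b) 5 4 3 1 dR dL].
(* numbered in the order [h1; h3; p1; p3; n1; n3; h2; p2; n2] of the labels of [mv_3] *)
Definition triangle1 kHP kHN kPN dH dP dN :=
  [:: ux kHP 0 2 6 7 dH dP; ux kHN 6 4 1 8 dH dN; ux kPN 7 8 3 5 dP dN].
Definition triangle2 kHP kHN kPN dH dP dN :=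
  [:: ux kPN 2 4 7 8 dP dN; ux kHN 0 8 6 5 dH dN; ux kHP 6 7 1 3 dH dP].

(** The oriented resolution splits off a circle, so a positive curl gives [-A^-2 delta - A^-4 = 1];
    the negative one is its mirror image. In a virtual curl an edge crosses itself, with sign 1. *)
Lemma curl_a_check k d : is_R1_kind k ->
  local_check 2 1 0 (terms (curl_a k d)) (sterm [:: sp d 0 1]) && inner_ok 2 1 (curl_a k d).
Proof. by case: k => [b||] // _; case: d; try case: b; vm_compute. Qed.

Lemma curl_b_check k d : is_R1_kind k ->
  local_check 2 1 0 (terms (curl_b k d)) (sterm [:: sp d 0 1]) && inner_ok 2 1 (curl_b k d).
Proof. by case: k => [b||] // _; case: d; try case: b; vm_compute. Qed.

Lemma bigon_check k dA dB : is_R1_kind k ->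
  local_check 4 2 0 (terms (bigon k dA dB)) (sterm [:: sp dA 0 2; sp dB 1 3]) &&
  inner_ok 4 2 (bigon k dA dB).
Proof. by case: k => [b||] // _; case: dA; case: dB; try case: b; vm_compute. Qed.

(** When the singular crossing is split into its two classical terms, each side is the sum of a
    bigon undone by R2 and of a full twist, which is the same on both sides. *)
Lemma twist_check b dL dR :
  [&& local_check 4 2 2 (terms (twist1 b dL dR)) (terms (twist2 b dL dR)),
      inner_ok 4 2 (twist1 b dL dR) & inner_ok 4 2 (twist2 b dL dR)].
Proof. by case: b; case: dL; case: dR; vm_compute. Qed.

(** When [hp == hn] both classical terms of a singular crossing satisfy the height condition, so RS1
    is a sum of two instances of R3. *)
Lemma triangle_check kHP kHN kPN dH dP dN :
    match kHP, kHN, kPN with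
    | UCl hp, UCl hn, UCl pn => ~~ [&& hp, pn & ~~ hn] && ~~ [&& ~~ hp, ~~ pn & hn]
    | UCl hp, UCl hn, USing => hp == hn
    | UVirt, UVirt, UVirt => true
    | UVirt, UVirt, UCl _ => true
    | UVirt, UVirt, USing => true
    | _, _, _ => false
    end ->
  [&& local_check 6 3 3 (terms (triangle1 kHP kHN kPN dH dP dN))
        (terms (triangle2 kHP kHN kPN dH dP dN)),
      inner_ok 6 3 (triangle1 kHP kHN kPN dH dP dN) &
      inner_ok 6 3 (triangle2 kHP kHN kPN dH dP dN)].
Proof.
case: kHP => [hp||]; case: kHN => [hn||]; case: kPN => [pn||] //;
  try case: hp; try case: hn; try case: pn => //; move=> // _;
  case: dH; case: dP; case: dN; by vm_compute.
Qed.

Section Invariance.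
Context (K : fieldType) (A h : K) (A0 : (A != 0)%R) (dA0 : (loop_value A != 0)%R).
Implicit Types D : diagram.

Lemma Rgen_move D D' : valid D -> valid D' -> move_step D D' -> Rgen A h D = Rgen A h D'.
Proof.
move=> vD vD' [T [T' [ps [rest [mv [pD [pD' lE]]]]]]]; move: lE.
case: mv pD pD' => {T T' ps}.
- move=> k d a x c /(curl_a_check d)/andP[ok iT] pD pD' lE.
  apply: (Rgen_reduce h A0 dA0 vD vD' (f := nth 0 [:: a; c; x]) (rest := rest)
    (j := join [:: sp d a c] id 0) ok iT).
  + by case: d {ok iT pD pD' lE}.
  + by [].
  + by rewrite /= !relab_ux.
  + by case: (d).
  + exact: pD'.
  + exact: lE.
- move=> k d a x c /(curl_b_check d)/andP[ok iT] pD pD' lE.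
  apply: (Rgen_reduce h A0 dA0 vD vD' (f := nth 0 [:: a; c; x]) (rest := rest)
    (j := join [:: sp d a c] id 0) ok iT).
  + by case: d {ok iT pD pD' lE}.
  + by [].
  + by rewrite /= !relab_ux.
  + by case: (d).
  + exact: pD'.
  + exact: lE.
- move=> k dA dB a b c d p q /(bigon_check dA dB)/andP[ok iT] pD pD' lE.
  apply: (Rgen_reduce h A0 dA0 vD vD' (f := nth 0 [:: a; b; c; d; p; q]) (rest := rest)
    (j := join [:: sp dA a c; sp dB b d] id 0) ok iT).
  + by case: dA {ok iT pD pD' lE}; case: dB.
  + by [].
  + by rewrite /= !relab_ux.
  + by case: (dA); case: (dB).
  + exact: pD'.
  + exact: lE.
- move=> kHP kHN kPN dH dP dN h1 h2 h3 p1 p2 p3 n1 n2 n3 h2' p2' n2'.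
  move=> /(triangle_check dH dP dN)/and3P[ok iT iT']; rewrite addn0 => pD pD' lE.
  apply: (Rgen_local h A0 dA0 vD vD' (f := nth 0 [:: h1; h3; p1; p3; n1; n3; h2; p2; n2])
    (f' := nth 0 [:: h1; h3; p1; p3; n1; n3; h2'; p2'; n2']) (rest := rest) ok iT iT').
  + by [].
  + by move=> i; rewrite !inE; do 5!(case/predU1P=> [-> //|]); move/eqP=> ->.
  + by rewrite /= !relab_ux.
  (* No strand is reconnected, so the rest of the diagram is relabelled by the identity. *)
  + by rewrite /= !relab_ux; move: pD'; rewrite (@eq_map _ _ _ id) ?map_id //; case.
  + by rewrite lE.
- move=> b dL dR l1 l2 l3 r1 r2 r3 l2' r2'.
  have /and3P[ok iT iT'] := twist_check b dL dR; rewrite addn0 => pD pD' lE.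
  apply: (Rgen_local h A0 dA0 vD vD' (f := nth 0 [:: l1; l3; r1; r3; l2; r2])
    (f' := nth 0 [:: l1; l3; r1; r3; l2'; r2']) (rest := rest) ok iT iT').
  + by [].
  + by move=> i; rewrite !inE; do 3!(case/predU1P=> [-> //|]); move/eqP=> ->.
  + by rewrite /= !relab_ux.
  + by rewrite /= !relab_ux; move: pD'; rewrite (@eq_map _ _ _ id) ?map_id //; case.
  + by rewrite lE.
Qed.

Local Open Scope ring_scope.

Lemma mem_terms_ins D x t : wf D -> t \in terms (crs D) -> x \in plabs t.2 -> x \in ins D.
Proof.
case/and3P=> _ _ /perm_mem io tD /(terms_labs tD) /orP[//|xo].
by rewrite io.
Qed.

Lemma Rgen_iso D D' : valid D -> valid D' -> iso_step D D' -> Rgen A h D = Rgen A h D'.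
Proof.
move=> vD vD' [f [finj [perm lE]]]; have [M /andP[labM labM']] := label_bound D D'.
have sz : size (crs D) = size (crs D').
  by rewrite -(size_map (relab f)); exact: Permutation.Permutation_length perm.
apply: (@Rgen_eq _ _ h A0 dA0 _ _ vD vD' M 0 labM labM'); first by rewrite sz addn0.
rewrite add0n lE -(weight_sum_perm h A0 M perm) /weight_sum term_sum_relab //; congr (_ * _).
have wfD : wf D by case/andP: vD.
apply: term_sum_eq_in => t tD; apply: count_weight_ext => e; apply/esym/wcount_relab => //.
apply/allP => x /(mem_terms_ins wfD tD) xD; rewrite (allP labM) //=; apply: (allP labM').
have -> : ins D' = ends_in (crs D') by [].
rewrite -(perm_mem (perm_flatten_map _ perm)).
have -> : flatten [seq [:: i1 c; i2 c] | c <- map (relab f) (crs D)] = map f (ins D).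
  by rewrite /ins map_flatten -!map_comp.
exact: map_f.
Qed.

Lemma Rgen_equiv D D' : ext_equiv D D' -> Rgen A h D = Rgen A h D'.
Proof.
elim=> // {D D'} [D D' [vD [vD' [mv|iso]]]|D1 D2 D3 _ -> //].
  exact: Rgen_move.
exact: Rgen_iso.
Qed.
End Invariance.

Lemma varA_neq0 : varA != 0%R.
Proof. by rewrite /varA tofrac_eq0 polyC_eq0 polyX_eq0. Qed.

Lemma loop_value_varA_neq0 : loop_value varA != 0%R.
Proof.
have A2 : (varA ^+ 2 != 0)%R by rewrite expf_neq0 // varA_neq0.
rewrite /loop_value -opprD oppr_eq0; apply/eqP => E.
(* Multiplication by [A ^ 2] clears the denominator and leaves a polynomial with constant
   coefficient 1. *)
have : (varA ^+ 4 + 1 = 0)%R.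
  by rewrite -[RHS](mul0r (varA ^+ 2)%R) -E mulrDl mulVf // -exprD.
apply/eqP; rewrite /varA -tofracXn -tofrac1 -tofracD tofrac_eq0 -polyC_exp -polyC1 -polyCD polyC_eq0.
apply/eqP => /(congr1 (fun p : {poly int} => p`_0)%R).
by rewrite coefD coefXn coef1 coef0.
Qed.

Theorem theorem3p12 (D D' : diagram) :
  valid D -> valid D' -> ext_equiv D D' -> R D = R D'.
Proof. by move=> _ _; apply: Rgen_equiv; [exact: varA_neq0|exact: loop_value_varA_neq0]. Qed.
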